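(* Let $k$ be a field of characteristic different from $2$ and let $L/k$ be a finite Galois extension with $L \neq k$ and Galois group $G$. Then the Dress map $h_{L/k}\colon A(G)\to GW(k)$ is injective if and only if $L=k(\sqrt{\alpha})$ for some $\alpha\in k^\times$ that is not a sum of squares in $k^\times$.
   Context: $A(G)$ is the Burnside ring of the finite group $G$: as an abelian group it is free on the classes $G/H$, with $H$ running over representatives of conjugacy classes of subgroups of $G$; addition is disjoint union and multiplication is cartesian product, with identity $G/G$. $GW(k)$ is the Grothendieck–Witt ring of $k$, generated as an abelian group by the one-dimensional forms $\langle a\rangle$, $a\in k^\times/(k^\times)^2$, with $\langle a\rangle+\langle b\rangle=\langle a,b\rangle$ (orthogonal sum) and $\langle a\rangle\langle b\rangle=\langle ab\rangle$. The Dress map $h_{L/k}$ is the ring homomorphism sending $G/H$ to the trace form $\mathrm{tr}_{L^H/k}\langle 1\rangle_{L^H}$, i.e. the class of the quadratic form $x\mapsto \mathrm{tr}_{L^H/k}(x^2)$ on the $k$-vector space $L^H$. ''$\alpha$ is a sum of squares in $k^\times$'' means $\alpha=x_1^2+\cdots+x_m^2$ for some $m\ge 1$ and $x_i\in k^\times$. *)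

(* Defs.v *)
From HB Require Import structures.
From mathcomp Require Import all_boot all_order all_algebra all_fingroup all_solvable all_field.
Set Implicit Arguments. Unset Strict Implicit. Unset Printing Implicit Defensive.
Import GRing.Theory.
Local Open Scope ring_scope.

(* A quadratic form of rank n is given by its symmetric Gram matrix A, with
   q(x) = x^T A x (char k <> 2 throughout). *)
Record qform (k : fieldType) := QForm { qdim : nat; qmx : 'M[k]_qdim }.

Definition qf_nondeg (k : fieldType) (q : qform k) :=
  (qmx q)^T = qmx q /\ \det (qmx q) != 0.

Definition qf_iso (k : fieldType) (q1 q2 : qform k) : Prop :=
  exists (P : 'M[k]_(qdim q1, qdim q2)) (Q : 'M[k]_(qdim q2, qdim q1)),
    [/\ P *m Q = 1%:M, Q *m P = 1%:M & P^T *m qmx q1 *m P = qmx q2].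

Definition qf_osum (k : fieldType) (q1 q2 : qform k) : qform k :=
  @QForm k (qdim q1 + qdim q2) (block_mx (qmx q1) 0 0 (qmx q2)).

Definition qf_zero (k : fieldType) : qform k := @QForm k 0 0.

Fixpoint qf_nsum (k : fieldType) (n : nat) (q : qform k) : qform k :=
  if n is n'.+1 then qf_osum q (qf_nsum n' q) else qf_zero k.

Definition qf_bigsum (k : fieldType) (s : seq (qform k)) : qform k :=
  foldr (@qf_osum k) (qf_zero k) s.

(* Elements of GW(k) (Grothendieck group of nondegenerate forms) are
   represented by formal differences [q1] - [q2]; two such differences are
   equal in GW(k) iff q1 + q2' and q1' + q2 are stably isometric. *)
Definition gw_eq (k : fieldType) (x y : qform k * qform k) : Prop :=
  exists t : qform k, qf_nondeg t /\
    qf_iso (qf_osum (qf_osum x.1 y.2) t) (qf_osum (qf_osum y.1 x.2) t).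

Section TraceForm.
Variables (k : fieldType) (L : fieldExtType k).

Definition ftrace (E : {vspace L}) (a : L) : k :=
  \sum_(i < \dim E) coord (vbasis E) i (a * (vbasis E)`_i).

Definition trace_form (E : {vspace L}) : qform k :=
  @QForm k (\dim E)
    (\matrix_(i < \dim E, j < \dim E) ftrace E ((vbasis E)`_i * (vbasis E)`_j)).
End TraceForm.

Section Dress.
Variables (k : fieldType) (L : splittingFieldType k).

Definition GalG := 'Gal({:L} / 1%VS)%g.

Definition subgroup_classes : {set {set {group gal_of {:L}}}} :=
  [set orbit 'JG%act GalG H | H in subgroups GalG].

Definition class_rep (C : {set {group gal_of {:L}}}) : {group gal_of {:L}} :=
  odflt 1%G [pick H in C].

(* An element of A(G) is an integer combination sum_C x_C [G/H_C] over the
   conjugacy classes C of subgroups (H_C a representative of C).  *)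
Definition burnside := {ffun {set {group gal_of {:L}}} -> int}.

Definition burnside_eq (x y : burnside) : Prop :=
  forall C, C \in subgroup_classes -> x C = y C.

Definition ipos (z : int) : nat := if z is Posz n then n else 0%N.
Definition ineg (z : int) : nat := if z is Negz n then n.+1 else 0%N.

Definition dress_basis (C : {set {group gal_of {:L}}}) : qform k :=
  trace_form (fixedField (class_rep C : {set gal_of {:L}})).

Definition dress (x : burnside) : qform k * qform k :=
  (qf_bigsum [seq qf_nsum (ipos (x C)) (dress_basis C) | C <- enum subgroup_classes],
   qf_bigsum [seq qf_nsum (ineg (x C)) (dress_basis C) | C <- enum subgroup_classes]).

Definition dress_injective : Prop :=
  forall x y : burnside, gw_eq (dress x) (dress y) -> burnside_eq x y.
End Dress.

Definition sum_of_squares (k : fieldType) (a : k) : Prop :=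
  exists s : seq k, [/\ s != [::], all (fun x => x != 0) s &
                        a = \sum_(x <- s) x ^+ 2].

(* Main.v *)
Require Import Defs.
From HB Require Import structures.
From mathcomp Require Import all_boot all_order all_algebra all_fingroup all_solvable all_field.
From mathcomp Require Import ring zify.
From Stdlib Require Import Setoid Morphisms Classical.
Set Implicit Arguments. Unset Strict Implicit. Unset Printing Implicit Defensive.
Import GRing.Theory.
Local Open Scope ring_scope.

(** Injectivity for L = k(sqrt alpha): there A(G) has basis G/G, G/1, mapped to
    <1> and <2, 2 alpha>. A relation in GW(k) forces j<2> = j<2 alpha> for some
    j > 0 by Witt cancellation, so 2 alpha is represented by j<2> and alpha is a
    sum of squares.

    Conversely, if s is a sum of squares in a field K, then N<s> = N<1> for some
    N > 0. Transferring forms from K = L^H down to k, this yields relations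
    between the trace forms of the fixed fields as soon as
    - H has order 2 and L = K(sqrt a) with a a sum of squares;
    - H is cyclic of order 4: the quadratic subextension of L / K is K(sqrt a)
      with a a sum of two squares, which relates it to K;
    - H is a Klein four-group, with subgroups A, B, C of order 2: then
      [L] + 2[K] and [L^A] + [L^B] + [L^C] agree after multiplication by some N;
    - H has odd prime order p: the diagonal entries of the trace form of L / K
      are sums of squares in L, hence in K by Springer's theorem on odd degree
      extensions, so N[L] = N p[K].
    Every group of order > 2 contains a subgroup of one of the last three kinds,
    so injectivity forces |G| = 2, with alpha not a sum of squares. *)

(** * Quadratic forms up to isometry *)

(** Multiplying by N costs nothing: A(G) is free as an abelian group, so a nonzero element with a
    positive multiple killed by h already refutes injectivity. Forms therefore matter only up to
    positive multiples, and there all classes <s>, s a sum of squares, coincide. In particular the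
    factors 2 carried by trace forms of quadratic extensions, as in <2, 2a>, disappear because 2 = 1
    + 1.

    The Klein relation is then the one between permutation characters: the regular character plus
    twice the trivial one is the sum of the three characters induced from the subgroups of order 2.
    Cyclic groups admit no relation of this kind, so for them the input is arithmetic, through norms
    in degree 4 and Springer's theorem in odd degree.

    Each relation is seen to be nonzero in A(G) because some subgroup on one side has an order that
    does not occur on the other.

    If -1 is a sum of squares, so is every element of the field, by a = ((a + 1) / 2)^2 - ((a - 1) /
    2)^2. This case is not treated separately; it returns wherever a denominator or a form might
    vanish. *)

Section Models.
Variable k : fieldType.
Implicit Types q : qform k.

Definition qev q (x y : 'rV[k]_(qdim q)) : k := (x *m qmx q *m y^T) 0 0.

(** Gram matrices depend on chosen bases, whereas most isometries below are natural maps between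
    spaces. This relation ties a matrix to a bilinear form on an abstract space, so that isometries
    can be built without coordinates: two matrices that model the same form are isometric. *)
Definition models (V : lmodType k) (B : V -> V -> k) q :=
  exists (f : V -> 'rV[k]_(qdim q)) (g : 'rV[k]_(qdim q) -> V),
    [/\ linear f, cancel f g, cancel g f & forall x y, B x y = qev (f x) (f y)].

Lemma can_linear (U V : lmodType k) (f : U -> V) (g : V -> U) :
  linear f -> cancel f g -> cancel g f -> linear g.
Proof. by move=> lf fK gK a u v; apply: (can_inj fK); rewrite lf !gK. Qed.

Lemma eq_qev n (A A' : 'M[k]_n) :
  (forall x y : 'rV_n, (x *m A *m y^T) 0 0 = (x *m A' *m y^T) 0 0) -> A = A'.
Proof.
move=> eA; apply/matrixP=> i j.
have := eA (delta_mx 0 i) (delta_mx 0 j).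
by rewrite -!rowE trmx_delta -!colE !mxE.
Qed.

Lemma models_iso (V : lmodType k) (B : V -> V -> k) q1 q2 :
  models B q1 -> models B q2 -> qf_iso q1 q2.
Proof.
case=> f1 [g1 [lf1 f1K g1K B1]] [f2 [g2 [lf2 f2K g2K B2]]].
have lg1 := can_linear lf1 f1K g1K; have lg2 := can_linear lf2 f2K g2K.
have lh : linear (f1 \o g2) by move=> a u v /=; rewrite lg2 lf1.
have lh' : linear (f2 \o g1) by move=> a u v /=; rewrite lg1 lf2.
pose h : {linear _ -> _} :=
  HB.pack (f1 \o g2) (GRing.isLinear.Build _ _ _ _ _ lh).
pose h' : {linear _ -> _} :=
  HB.pack (f2 \o g1) (GRing.isLinear.Build _ _ _ _ _ lh').
(* The transposes pass from row vectors, on which [qev] acts, to the column convention P^T A P of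
   [qf_iso]. *)
exists (lin1_mx h)^T, (lin1_mx h')^T; rewrite -!trmx_mul !trmxK; split.
- apply/eqP; rewrite -trmx1 (inj_eq trmx_inj); apply/eqP/row_matrixP=> i.
  by rewrite rowE mulmxA !mul_rV_lin1 /= rowE mulmx1 f2K g1K.
- apply/eqP; rewrite -trmx1 (inj_eq trmx_inj); apply/eqP/row_matrixP=> i.
  by rewrite rowE mulmxA !mul_rV_lin1 /= rowE mulmx1 f1K g2K.
apply: eq_qev => x y; rewrite !mulmxA mul_rV_lin1 -[_ *m y^T]mulmxA.
by rewrite -trmx_mul mul_rV_lin1 -[LHS]/(qev _ _) -B1 B2 !g2K.
Qed.

Lemma models_isom (V W : lmodType k) (B : V -> V -> k) (B' : W -> W -> k) f g q :
  linear f -> cancel f g -> cancel g f ->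
  (forall x y, B x y = B' (f x) (f y)) -> models B' q -> models B q.
Proof.
move=> lf fK gK BB' [f' [g' [lf' f'K g'K B'q]]].
exists (f' \o f), (g \o g'); split; last by move=> x y; rewrite BB' B'q.
- by move=> a u v /=; rewrite lf lf'.
- exact: can_comp.
- exact: can_comp.
Qed.

Lemma qev_models q : models (@qev q) q.
Proof. by exists id, id; split. Qed.

Lemma qf_iso_models (V : lmodType k) (B : V -> V -> k) q1 q2 :
  qf_iso q1 q2 -> models B q1 -> models B q2.
Proof.
move=> [P [Q [PQ QP AB]]] [f [g [lf fK gK Bq]]].
exists (fun x => f x *m Q^T), (fun y => g (y *m P^T)); split.
- by move=> a u v; rewrite lf mulmxDl scalemxAl.
- by move=> x; rewrite -mulmxA -trmx_mul PQ trmx1 mulmx1.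
- by move=> x; rewrite gK -mulmxA -trmx_mul QP trmx1 mulmx1.
move=> x y; rewrite Bq /qev -AB trmx_mul trmxK !mulmxA.
rewrite -(mulmxA _ Q^T) -trmx_mul PQ trmx1 mulmx1.
by rewrite -(mulmxA _ P) PQ mulmx1.
Qed.

Lemma models_osum (V W : lmodType k) (B : V -> V -> k) (B' : W -> W -> k) q q' :
  models B q -> models B' q' ->
  models (fun x y : V * W => B x.1 y.1 + B' x.2 y.2) (qf_osum q q').
Proof.
move=> [f [g [lf fK gK Bq]]] [f' [g' [lf' f'K g'K B'q]]].
exists (fun x : V * W => row_mx (f x.1) (f' x.2)).
exists (fun y => (g (lsubmx y), g' (rsubmx y))); split.
- by move=> a u v /=; rewrite lf lf' scale_row_mx add_row_mx.
- by case=> x y /=; rewrite row_mxKl row_mxKr fK f'K.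
- by move=> y /=; rewrite gK g'K hsubmxK.
move=> x y; rewrite Bq B'q /qev /= mul_row_block !mulmx0 addr0 add0r.
by rewrite tr_row_mx mul_row_col [RHS]mxE.
Qed.

Lemma qf_iso_refl q : qf_iso q q.
Proof. exact: models_iso (qev_models q) (qev_models q). Qed.

Lemma qf_iso_sym q1 q2 : qf_iso q1 q2 -> qf_iso q2 q1.
Proof.
by move=> i12; apply: models_iso (qf_iso_models i12 (qev_models q1)) (qev_models q1).
Qed.

Lemma qf_iso_trans q1 q2 q3 : qf_iso q1 q2 -> qf_iso q2 q3 -> qf_iso q1 q3.
Proof.
move=> i12 i23; apply: models_iso (qev_models q1) _.
exact/(qf_iso_models i23)/(qf_iso_models i12)/qev_models.
Qed.

End Models.

Add Parametric Relation (k : fieldType) : (qform k) (@qf_iso k)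
  reflexivity proved by (@qf_iso_refl k)
  symmetry proved by (@qf_iso_sym k)
  transitivity proved by (@qf_iso_trans k) as qf_iso_rel.

#[local] Hint Resolve qf_iso_refl : core.

Add Parametric Morphism (k : fieldType) : (@qf_osum k)
  with signature (@qf_iso k) ==> (@qf_iso k) ==> (@qf_iso k) as qf_osum_iso.
Proof.
move=> q1 q2 i12 q3 q4 i34.
apply: models_iso (models_osum (qev_models q1) (qev_models q3)) _.
by apply: models_osum; [apply: qf_iso_models i12 _ | apply: qf_iso_models i34 _];
  apply: qev_models.
Qed.

Section QfMonoid.
Variable k : fieldType.
Implicit Types q : qform k.
Local Notation "q1 ≃ q2" := (@qf_iso k q1 q2) (at level 70).
Local Notation "q1 ⊥ q2" := (@qf_osum k q1 q2) (at level 50, left associativity).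

Lemma qf_osumC q1 q2 : q1 ⊥ q2 ≃ q2 ⊥ q1.
Proof.
apply: models_iso (models_osum (qev_models q1) (qev_models q2)) _.
apply: models_isom (models_osum (qev_models q2) (qev_models q1)).
- by instantiate (1 := fun x => (x.2, x.1)); move=> a u v.
- by instantiate (1 := fun x => (x.2, x.1)); case.
- by case.
by move=> x y; rewrite addrC.
Qed.

Lemma qf_osumA q1 q2 q3 : q1 ⊥ (q2 ⊥ q3) ≃ q1 ⊥ q2 ⊥ q3.
Proof.
apply: models_iso
  (models_osum (qev_models q1) (models_osum (qev_models q2) (qev_models q3))) _.
apply: models_isom
  (models_osum (models_osum (qev_models q1) (qev_models q2)) (qev_models q3)).
- by instantiate (1 := fun x => ((x.1, x.2.1), x.2.2)); move=> a u v.
- by instantiate (1 := fun x => (x.1.1, (x.1.2, x.2))); case=> ? [].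
- by case=> [[]].
by move=> x y; rewrite addrA.
Qed.

Lemma qf_osum0 q : q ⊥ qf_zero k ≃ q.
Proof.
apply: models_iso (models_osum (qev_models q) (qev_models (qf_zero k))) _.
apply: models_isom (qev_models q).
- by instantiate (1 := fst); move=> a u v.
- instantiate (1 := fun x => (x, 0)); case=> x y /=; congr (_, _).
  by apply/rowP; case.
- by [].
by move=> x y; rewrite [X in _ + X]/qev /= [X in _ + X]mxE big_ord0 addr0.
Qed.

Lemma qf_0osum q : qf_zero k ⊥ q ≃ q.
Proof. by rewrite qf_osumC qf_osum0. Qed.

Lemma qf_osumCA q1 q2 q3 : q1 ⊥ (q2 ⊥ q3) ≃ q2 ⊥ (q1 ⊥ q3).
Proof. by rewrite !qf_osumA (qf_osumC q1). Qed.

Lemma qf_osumACA q1 q2 q3 q4 : q1 ⊥ q2 ⊥ (q3 ⊥ q4) ≃ q1 ⊥ q3 ⊥ (q2 ⊥ q4).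
Proof. by rewrite -!qf_osumA (qf_osumCA q2). Qed.

Lemma qf_nsum_iso n q1 q2 : q1 ≃ q2 -> qf_nsum n q1 ≃ qf_nsum n q2.
Proof. by move=> i12; elim: n => [|n IH] //=; rewrite IH i12. Qed.

Lemma qf_nsumD m n q : qf_nsum (m + n) q ≃ qf_nsum m q ⊥ qf_nsum n q.
Proof.
by elim: m => [|m IH] /=; [rewrite qf_0osum | rewrite IH qf_osumA].
Qed.

Lemma qf_nsum_osum n q1 q2 :
  qf_nsum n (q1 ⊥ q2) ≃ qf_nsum n q1 ⊥ qf_nsum n q2.
Proof.
elim: n => [|n IH] /=; first by rewrite qf_osum0.
by rewrite IH qf_osumACA.
Qed.

Lemma qf_nsumM m n q : qf_nsum (m * n) q ≃ qf_nsum m (qf_nsum n q).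
Proof.
elim: m => [|m IH] //.
by rewrite mulSn qf_nsumD /= IH.
Qed.

Lemma qf_bigsum_cat s1 s2 :
  qf_bigsum (s1 ++ s2) ≃ qf_bigsum s1 ⊥ qf_bigsum s2.
Proof.
by elim: s1 => [|q s IH] /=; [rewrite qf_0osum | rewrite IH qf_osumA].
Qed.

Lemma qf_bigsum_nseq n q : qf_bigsum (nseq n q) = qf_nsum n q.
Proof. by elim: n => //= n ->. Qed.

End QfMonoid.

Add Parametric Morphism (k : fieldType) (n : nat) : (@qf_nsum k n)
  with signature (@qf_iso k) ==> (@qf_iso k) as qf_nsum_mor.
Proof. exact: qf_nsum_iso. Qed.

(** * Transfer of quadratic forms *)

Lemma scalar_sum (k : fieldType) (V : lmodType k) (h : V -> k) (I : finType)
    (c : I -> k) (u : I -> V) :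
  scalar h -> h (\sum_i c i *: u i) = \sum_i c i * h (u i).
Proof.
move=> hl; have h0 : h 0 = 0.
  have /eqP := hl 1 0 0; rewrite scale1r addr0 mul1r.
  by rewrite -subr_eq0 opprD addNKr oppr_eq0 => /eqP.
by elim/big_rec2: _ => //= i a b _ <-; apply: hl.
Qed.

Lemma frame_models (k : fieldType) (V : lmodType k) n (e : 'I_n -> V)
    (c : V -> 'rV[k]_n) (B : V -> V -> k) :
  linear c -> (forall x, x = \sum_i c x 0 i *: e i) ->
  (forall i, c (e i) = delta_mx 0 i) ->
  (forall y, scalar (B^~ y)) -> (forall x, scalar (B x)) ->
  models B (@QForm k n (\matrix_(i, j) B (e i) (e j))).
Proof.
move=> cl exp ce lB rB; exists c, (fun r => \sum_i r 0 i *: e i); split=> [//|x|r|x y].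
- by rewrite /= -exp.
- rewrite [r in RHS]row_sum_delta.
  pose cL : {linear V -> 'rV_n} := HB.pack c (GRing.isLinear.Build _ _ _ _ _ cl).
  rewrite -[c]/(cL : _ -> _) linear_sum; apply: eq_bigr => i _.
  by rewrite linearZ /= ce.
rewrite {1}[x]exp {1}[y]exp (scalar_sum _ _ (lB _)) /qev /= mxE.
under [RHS]eq_bigr => j _ do rewrite mxE mulr_suml.
rewrite exchange_big /=; apply: eq_bigr => i _.
rewrite (scalar_sum _ _ (rB _)) mulr_sumr; apply: eq_bigr => j _.
by rewrite !mxE -mulrA [B _ _ * _]mulrC.
Qed.

Section Gram.
Variables (k : fieldType) (V : vectType k) (B : V -> V -> k).

Definition gram : qform k :=
  @QForm k (\dim {:V}) (\matrix_(i, j) B (vbasis {:V})`_i (vbasis {:V})`_j).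

Lemma gram_models :
  (forall y, scalar (B^~ y)) -> (forall x, scalar (B x)) -> models B gram.
Proof.
move=> lB rB.
apply: (frame_models (c := fun x => \row_i coord (vbasis {:V}) i x)) => //.
- by move=> a u v; apply/rowP=> i; rewrite !mxE linearP.
- move=> x; rewrite {1}(coord_vbasis (memvf x)).
  by apply: eq_bigr => i _; rewrite mxE.
move=> i; apply/rowP=> j; rewrite !mxE eqxx /= coord_free 1?eq_sym //.
exact: basis_free (vbasisP _).
Qed.

End Gram.

Definition qf1 (k : fieldType) (c : k) : qform k := @QForm k 1 c%:M.

Section Transfer.
Variables (k : fieldType) (F : fieldExtType k) (t : F -> k).
Hypothesis t_lin : scalar t.
Implicit Types q : qform F.
Local Notation "q1 ≃ q2" := (qf_iso q1 q2) (at level 70).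

Let rw m (x : {ffun 'I_m -> F}) : 'rV[F]_m := \row_i x i.

(** The Scharlau transfer along t. Finite functions stand in for row vectors because they carry the
    structure of a vector space over k, while ['rV[F]] is one over F. *)
Definition qf_transfer_form q (x y : {ffun 'I_(qdim q) -> F}) : k :=
  t (qev (\row_i x i) (\row_i y i)).

Definition qf_transfer q : qform k := gram (@qf_transfer_form q).

Let rwP m a (x y : {ffun 'I_m -> F}) : rw (a *: x + y) = a%:A *: rw x + rw y.
Proof. by apply/rowP=> i; rewrite !mxE !ffunE mulr_algl. Qed.

Lemma qf_transfer_models q : models (@qf_transfer_form q) (qf_transfer q).
Proof.
apply: gram_models => [y a u v|x a u v]; rewrite /qf_transfer_form.
  rewrite -/(rw _) rwP /qev mulmxDl mulmxDl -!scalemxAl !mxE mulr_algl.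
  exact: t_lin.
rewrite -![\row_i _ i]/(rw _) rwP /qev linearD linearZ /= mulmxDr -scalemxAr.
rewrite !mxE mulr_algl; exact: t_lin.
Qed.

Lemma qf_transfer_iso q1 q2 : q1 ≃ q2 -> qf_transfer q1 ≃ qf_transfer q2.
Proof.
move=> [P [Q [PQ QP AB]]]; apply: models_iso (qf_transfer_models q1) _.
pose f x : {ffun 'I_(qdim q2) -> F} := [ffun i => (rw x *m Q^T) 0 i].
pose g y : {ffun 'I_(qdim q1) -> F} := [ffun i => (rw y *m P^T) 0 i].
have rwf x : rw (f x) = rw x *m Q^T by apply/rowP=> i; rewrite mxE ffunE.
have rwg x : rw (g x) = rw x *m P^T by apply/rowP=> i; rewrite mxE ffunE.
have rw_inj m : injective (@rw m).
  by move=> x y /rowP e; apply/ffunP=> i; have := e i; rewrite !mxE.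
apply: (@models_isom _ _ _ _ _ f g) (qf_transfer_models q2).
- by move=> a u v; apply: rw_inj; rewrite rwf !rwP !rwf mulmxDl scalemxAl.
- by move=> x; apply: rw_inj; rewrite rwg rwf -mulmxA -trmx_mul PQ trmx1 mulmx1.
- by move=> x; apply: rw_inj; rewrite rwf rwg -mulmxA -trmx_mul QP trmx1 mulmx1.
move=> x y; rewrite /qf_transfer_form -![\row_i _ i]/(rw _) !rwf /qev -AB.
rewrite trmx_mul trmxK !mulmxA.
rewrite -(mulmxA _ Q^T) -trmx_mul PQ trmx1 mulmx1.
by rewrite -(mulmxA _ P) PQ mulmx1.
Qed.

Lemma qf_transfer_osum q1 q2 :
  qf_transfer (qf_osum q1 q2) ≃ qf_osum (qf_transfer q1) (qf_transfer q2).
Proof.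
apply: models_iso (models_osum (qf_transfer_models q1) (qf_transfer_models q2)).
pose f (x : {ffun 'I_(qdim q1) -> F} * {ffun 'I_(qdim q2) -> F})
  : {ffun 'I_(qdim q1 + qdim q2) -> F} := [ffun i => row_mx (rw x.1) (rw x.2) 0 i].
pose g (y : {ffun 'I_(qdim q1 + qdim q2) -> F}) :=
  ([ffun i => y (lshift _ i)] : {ffun 'I_(qdim q1) -> F},
   [ffun i => y (rshift _ i)] : {ffun 'I_(qdim q2) -> F}).
have rwf x : rw (f x) = row_mx (rw x.1) (rw x.2) by apply/rowP=> i; rewrite mxE ffunE.
have rw_inj m : injective (@rw m).
  by move=> x y /rowP e; apply/ffunP=> i; have := e i; rewrite !mxE.
apply: (@models_isom _ _ _ _ _ f g) (qf_transfer_models (qf_osum q1 q2)).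
- move=> a u v; apply: rw_inj; rewrite rwf !rwP !rwf.
  by rewrite scale_row_mx add_row_mx.
- case=> x y; congr (_, _); apply/ffunP=> i; rewrite !ffunE.
    by rewrite row_mxEl mxE.
  by rewrite row_mxEr mxE.
- move=> y; apply: rw_inj; rewrite rwf /=; apply/rowP=> i; rewrite !mxE.
  by case: splitP => j ej; rewrite mxE ffunE; congr (y _); apply: val_inj.
move=> x y; rewrite /qf_transfer_form -![\row_i _ i]/(rw _) !rwf /qev /=.
rewrite mul_row_block !mulmx0 addr0 add0r tr_row_mx mul_row_col [in RHS]mxE.
by rewrite -[X in X + _]mul1r -t_lin scale1r.
Qed.

Lemma qf_transfer_qf1 c : models (fun x y : F => t (c * x * y)) (qf_transfer (qf1 c)).
Proof.
apply: models_isom (qf_transfer_models (qf1 c)).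
- by instantiate (1 := fun x => [ffun=> x]); move=> a u v; apply/ffunP=> i; rewrite !ffunE.
- by instantiate (1 := fun y => y 0); move=> x; rewrite ffunE.
- by move=> x; apply/ffunP=> i; rewrite !ffunE (ord1 i).
move=> x y; rewrite /qf_transfer_form /qev /= mul_mx_scalar -scalemxAl mxE.
by rewrite mxE big_ord1 !mxE !ffunE mulrA.
Qed.

Lemma qf_transfer_zero : qf_transfer (qf_zero F) ≃ qf_zero k.
Proof.
apply: models_iso (qf_transfer_models _) _.
apply: models_isom (qev_models (qf_zero k)).
- by instantiate (1 := fun=> 0); move=> a u v; rewrite scaler0 addr0.
- by instantiate (1 := fun=> 0); move=> x; apply/ffunP; case.
- by move=> x; apply/rowP; case.
move=> x y; rewrite /qf_transfer_form /qev /= !mxE !big_ord0.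
by have := t_lin 1 0 0; rewrite scaler0 addr0 mul1r => /eqP;
  rewrite -subr_eq0 opprD addNKr oppr_eq0 => /eqP.
Qed.

Lemma qf_transfer_bigsum s :
  qf_transfer (qf_bigsum s) ≃ qf_bigsum [seq qf_transfer q | q <- s].
Proof.
by elim: s => [|q s IH] /=; rewrite ?qf_transfer_zero // qf_transfer_osum IH.
Qed.

Lemma qf_transfer_nsum n q : qf_transfer (qf_nsum n q) ≃ qf_nsum n (qf_transfer q).
Proof. by rewrite -!qf_bigsum_nseq qf_transfer_bigsum map_nseq. Qed.

End Transfer.

(** * Trace forms and towers *)

Section ScaledTraceForm.
Variables (k : fieldType) (L : fieldExtType k).
Implicit Types (E K : {subfield L}) (U : {vspace L}).
Local Notation "q1 ≃ q2" := (qf_iso q1 q2) (at level 70).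

(** Expanding v_i in v', and u v'_j in v, turns both sides into the double sum of c'_j(v_i) c_i(u
    v'_j). Arbitrary index types allow the product basis of a tower and a basis moved by an
    automorphism. *)
Lemma trace_indep U (I J : finType) (v : I -> L) (c : I -> L -> k)
    (v' : J -> L) (c' : J -> L -> k) (u : L -> L) :
  (forall i, scalar (c i)) -> (forall i, v i \in U) ->
  {in U, forall x, x = \sum_i c i x *: v i} ->
  (forall j, scalar (c' j)) -> (forall j, v' j \in U) ->
  {in U, forall x, x = \sum_j c' j x *: v' j} ->
  (forall a : k, {morph u : x y / a *: x + y}) -> {in U, forall x, u x \in U} ->
  \sum_i c i (u (v i)) = \sum_j c' j (u (v' j)).
Proof.
move=> cl vU vP c'l v'U v'P ul uU.
have cul i : scalar (c i \o u) by move=> a x y /=; rewrite ul cl.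
transitivity (\sum_i \sum_j c' j (v i) * c i (u (v' j))).
  apply: eq_bigr => i _; rewrite {1}(v'P _ (vU i)).
  exact: (scalar_sum _ _ (cul i)).
rewrite exchange_big; apply: eq_bigr => j _ /=.
rewrite {2}(vP _ (uU _ (v'U j))) (scalar_sum _ _ (c'l j)).
by apply: eq_bigr => i _; rewrite mulrC.
Qed.

Lemma ftrace_scalar U : scalar (@ftrace k L U).
Proof.
move=> a x y; rewrite /ftrace mulr_sumr -big_split; apply: eq_bigr => i _ /=.
by rewrite mulrDl -scalerAl linearP.
Qed.

(** The scaled trace form tr(c x y). Scalings are unavoidable, since descending a trace form along a
    subextension turns <1> into forms such as <2, 2d>. *)
Definition tf U (c : L) : qform k :=
  @QForm k (\dim U) (\matrix_(i, j) ftrace U (c * (vbasis U)`_i * (vbasis U)`_j)).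

Lemma trace_form_tf U : trace_form U = tf U 1.
Proof. by congr QForm; apply/matrixP=> i j; rewrite !mxE mul1r. Qed.

Lemma tf_models U c :
  models (fun x y : subvs_of U => ftrace U (c * vsval x * vsval y)) (tf U c).
Proof.
have bU (i : 'I_(\dim U)) : (vbasis U)`_i \in U.
  by apply: vbasis_mem; rewrite mem_nth ?size_tuple.
have -> : tf U c = @QForm k (\dim U) (\matrix_(i, j)
    (fun x y : subvs_of U => ftrace U (c * vsval x * vsval y))
     (vsproj U (vbasis U)`_i) (vsproj U (vbasis U)`_j)).
  by congr QForm; apply/matrixP=> i j; rewrite !mxE !vsprojK.
apply: (frame_models (e := fun i : 'I_(\dim U) => vsproj U (vbasis U)`_i)
   (c := fun x => \row_i coord (vbasis U) i (vsval x))).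
- by move=> a x y; apply/rowP=> i; rewrite !mxE !linearP.
- move=> x; apply: val_inj; rewrite /= {1}(coord_vbasis (valP x)) linear_sum.
  by apply: eq_bigr => i _; rewrite linearZ /= vsprojK // mxE.
- move=> i; apply/rowP=> j; rewrite !mxE vsprojK // eqxx /=.
  by rewrite coord_free 1?eq_sym // (basis_free (vbasisP _)).
- move=> y a u v; rewrite linearP mulrDr mulrDl -scalerAr -scalerAl.
  exact: ftrace_scalar.
move=> x a u v; rewrite linearP mulrDr -scalerAr.
exact: ftrace_scalar.
Qed.

Definition tr_sub K (x : subvs_of K) : k := ftrace K (vsval x).

Lemma tr_sub_scalar K : scalar (@tr_sub K).
Proof. by move=> a x y; rewrite /tr_sub linearP ftrace_scalar. Qed.

(** Through this identity an isometry of diagonal forms over K becomes a relation between scaled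
    trace forms over k. *)
Lemma tf_transfer K (s : subvs_of K) : tf K (vsval s) ≃ qf_transfer (@tr_sub K) (qf1 s).
Proof.
apply: models_iso (tf_models K (vsval s)) _.
exact: (qf_transfer_qf1 (@tr_sub_scalar K)).
Qed.

(** * Descent along a tower: [w] is a basis of E / K with coordinates [p] *)

Section Tower.
Variables (K E : {subfield L}) (n : nat) (w : 'I_n -> L) (p : 'I_n -> L -> L).
Hypothesis sKE : (K <= E)%VS.
Hypothesis wE : forall i, w i \in E.
Hypothesis pK : forall i, {in E, forall x, p i x \in K}.
Hypothesis pP : {in E, forall x, x = \sum_i p i x * w i}.
Hypothesis pl : forall i, {in K, forall a x y, p i (a * x + y) = a * p i x + p i y}.
Hypothesis pw : forall i j, p i (w j) = (i == j)%:R.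

Let p_lin i (a : k) x y : p i (a *: x + y) = a *: p i x + p i y.
Proof. by rewrite -[a *: x]mulr_algl pl ?rpredZ ?mem1v // mulr_algl. Qed.

Let p0 i : p i 0 = 0.
Proof.
apply: (addIr (p i 0)); rewrite add0r.
by have := p_lin i 1 0 0; rewrite scaler0 scale1r addr0 => <-.
Qed.

(** Transitivity of the trace: products of a basis of K / k with [w] form a basis of E / k, and the
    inner sum is the trace of x from E to K. *)
Lemma ftrace_tower : {in E, forall x, ftrace E x = ftrace K (\sum_i p i (x * w i))}.
Proof.
move=> x xE.
rewrite /ftrace (trace_indep (U := E) (J := ('I_n * 'I_(\dim K))%type)
  (v := fun i : 'I_(\dim E) => (vbasis E)`_i) (c := fun i y => coord (vbasis E) i y)
  (v' := fun ij => (vbasis K)`_ij.2 * w ij.1)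
  (c' := fun ij y => coord (vbasis K) ij.2 (p ij.1 y)) (u := fun y => x * y)).
- rewrite -(pair_bigA _ (fun i j => coord (vbasis K) j (p i (x * ((vbasis K)`_j * w i))))) /=.
  rewrite exchange_big; apply: eq_bigr => j _ /=.
  rewrite -linear_sum mulr_suml; congr (coord _ _ _); apply: eq_bigr => i _.
  have bK : (vbasis K)`_j \in K by apply: vbasis_mem; rewrite mem_nth ?size_tuple.
  by have := pl i bK (x * w i) 0; rewrite mulrCA p0 !addr0 => ->; rewrite mulrC.
- by move=> i a y z; rewrite linearP.
- by move=> i; apply: vbasis_mem; rewrite mem_nth ?size_tuple.
- by move=> y yE; rewrite {1}(coord_vbasis yE).
- by move=> [i j] a y z; rewrite p_lin linearP.
- move=> [i j] /=; rewrite rpredM ?wE // (subvP sKE) //.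
  by apply: vbasis_mem; rewrite mem_nth ?size_tuple.
- move=> y yE /=.
  rewrite -(pair_bigA _
    (fun i j => coord (vbasis K) j (p i y) *: ((vbasis K)`_j * w i))) /=.
  rewrite {1}(pP yE); apply: eq_bigr => i _.
  rewrite {1}(coord_vbasis (pK i yE)) mulr_suml; apply: eq_bigr => j _.
  by rewrite scalerAl.
- by move=> a y z; rewrite mulrDr scalerAr.
- by move=> y yE; rewrite rpredM.
Qed.

(** [M] is the Gram matrix over K of tr_{E/K}(c x y) in the basis [w]; by transitivity of the trace,
    its transfer to k is the scaled trace form of E. *)
Lemma tf_gram c (M : 'M[subvs_of K]_n) :
  c \in E ->
  (forall i j, vsval (M i j) = \sum_l p l (c * w i * w j * w l)) ->
  tf E c ≃ qf_transfer (@tr_sub K) (@QForm _ n M).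
Proof.
move=> cE MP; apply: models_iso (qf_transfer_models (@tr_sub_scalar K) _).
pose f (x : {ffun 'I_n -> subvs_of K}) := vsproj E (\sum_i vsval (x i) * w i).
pose g (y : subvs_of E) : {ffun 'I_n -> subvs_of K} :=
  [ffun i => vsproj K (p i (vsval y))].
have sE (x : {ffun 'I_n -> subvs_of K}) : \sum_i vsval (x i) * w i \in E.
  by apply: rpred_sum => i _; rewrite rpredM ?wE // (subvP sKE) ?(valP (x i)).
have p_sum i (I : finType) (a b : I -> L) : (forall l, a l \in K) ->
    p i (\sum_l a l * b l) = \sum_l a l * p i (b l).
  move=> aK.
  by elim/big_rec2: _ => //= l y z _ <-; apply: pl.
have fE x : vsval (f x) = \sum_i vsval (x i) * w i by rewrite vsprojK.
apply: (@models_isom _ _ _ _ _ f g) (tf_models E c).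
- move=> a x y; apply: val_inj; rewrite /= vsprojK ?sE // !vsprojK ?sE //.
  rewrite scaler_sumr -big_split; apply: eq_bigr => i _ /=.
  by rewrite !ffunE linearP mulrDl scalerAl.
- move=> x; apply/ffunP=> i; apply: val_inj; rewrite ffunE /= fE.
  rewrite p_sum => [|l]; last exact: valP (x l).
  rewrite (bigD1 i) //= pw eqxx mulr1 big1 ?addr0; last first.
    by move=> j /negPf ij; rewrite pw eq_sym ij mulr0.
  by rewrite vsprojK ?(valP (x i)).
- move=> y; apply: val_inj; rewrite /= vsprojK ?sE // [RHS](pP (valP y)).
  by apply: eq_bigr => i _; rewrite ffunE vsprojK // pK ?(valP y).
move=> x y; rewrite !fE ftrace_tower; last by rewrite !rpredM ?sE.
congr (ftrace K _); symmetry.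
have sumF (I : finType) (h : I -> subvs_of K) : vsval (\sum_i h i) = \sum_i vsval (h i).
  exact: (linear_sum (vsval : {linear subvs_of K -> L})).
rewrite /qev /= mxE sumF.
transitivity (\sum_l \sum_j \sum_i
   vsval (x i) * p l (c * w i * w j * w l) * vsval (y j)).
  apply: eq_bigr => l _.
  transitivity (p l (\sum_j vsval (y j) * (\sum_i vsval (x i) * (c * w i * w j * w l)))).
    congr (p l _); set S := (X in c * X * _ * _); rewrite mulr_sumr mulr_suml.
    apply: eq_bigr => j _.
    transitivity (vsval (y j) * (S * (c * w j * w l))); first by ring.
    by rewrite mulr_suml; congr (_ * _); apply: eq_bigr => i _; ring.
  rewrite p_sum => [|j]; last exact: valP (y j).
  apply: eq_bigr => j _; rewrite p_sum => [|i]; last exact: valP (x i).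
  by rewrite mulr_sumr; apply: eq_bigr => i _; ring.
rewrite exchange_big; apply: eq_bigr => j _ /=.
rewrite exchange_big !mxE sumF mulr_suml; apply: eq_bigr => i _ /=.
by rewrite -mulr_suml -mulr_sumr mxE -MP.
Qed.

End Tower.
End ScaledTraceForm.

(** * Sums of squares and multiples of forms *)

Section SumsOfSquares.
Variable F : fieldType.
Local Notation "q1 ≃ q2" := (qf_iso q1 q2) (at level 70).

(** Unlike in [sum_of_squares], zero terms and the empty sum are allowed, which gives closure under
    sums and products. The two notions agree on nonzero elements, by dropping the zero terms. *)
Definition sos (a : F) := exists s : seq F, a = \sum_(x <- s) x ^+ 2.

Lemma sosX2 x : sos (x ^+ 2).
Proof. by exists [:: x]; rewrite big_seq1. Qed.

Lemma sosD a b : sos a -> sos b -> sos (a + b).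
Proof. by case=> s -> [r ->]; exists (s ++ r); rewrite big_cat. Qed.

Lemma sos0 : sos 0.
Proof. by exists [::]; rewrite big_nil. Qed.

Lemma sosMX a x : sos a -> sos (x ^+ 2 * a).
Proof.
case=> s ->; exists [seq x * y | y <- s]; rewrite big_map mulr_sumr.
by apply: eq_bigr => y _; rewrite exprMn.
Qed.

Lemma sosMn a n : sos a -> sos (a *+ n).
Proof.
by move=> sa; elim: n => [|n IH]; [rewrite mulr0n; apply: sos0 | rewrite mulrS; apply: sosD].
Qed.

Lemma sosM a b : sos a -> sos b -> sos (a * b).
Proof.
move=> [s ->] sb; elim: s => [|x s IH]; first by rewrite big_nil mul0r; apply: sos0.
by rewrite big_cons mulrDl; apply: sosD => //; apply: sosMX.
Qed.

Lemma sum_of_squaresP a : a != 0 -> sum_of_squares a <-> sos a.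
Proof.
move=> a0; split=> [[s [_ _ ->]]|[s as2]]; first by exists s.
have e : a = \sum_(x <- s | x != 0) x ^+ 2.
  rewrite as2 [LHS](bigID (fun x => x != 0)) /= [X in _ + X]big1 ?addr0 // => x.
  by rewrite negbK => /eqP ->; rewrite expr0n.
exists [seq x <- s | x != 0]; split; last by rewrite big_filter.
  by apply: contra_neq a0 => s0; rewrite e -big_filter s0 big_nil.
exact: filter_all.
Qed.

(* If [A] realises multiplication of the unit form by [s], then the block
   matrix [[x, A], [- A^T, x]] realises multiplication by [x ^+ 2 + s]. *)
Lemma sos_similitude a : sos a ->
  exists (N : nat) (A : 'M[F]_N), [/\ (0 < N)%N, A *m A^T = a%:M & A^T *m A = a%:M].
Proof.
case=> s ->; elim: s => [|x s [N [A [N0 IH1 IH2]]]].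
  by exists 1%N, 0; rewrite big_nil trmx0 mulmx0 raddf0.
exists (N + N)%N, (block_mx x%:M A (- A^T) x%:M).
rewrite big_cons addn_gt0 N0 scalar_mx_block tr_block_mx !tr_scalar_mx linearN /=.
rewrite trmxK !mulmx_block ?mulmxN ?mulNmx ?mulmxN ?opprK !IH1 !IH2.
rewrite -!scalar_mxM -!raddfD /= -expr2 !mul_scalar_mx !mul_mx_scalar.
by split=> //; congr block_mx; rewrite ?addNr ?subrr // addrC.
Qed.

Lemma qf_nsum_qf1 n (c : F) : qf_nsum n (qf1 c) ≃ @QForm F n c%:M.
Proof.
elim: n => [|n IH] /=.
  by rewrite /qf_zero (_ : c%:M = 0) //; apply/matrixP; case.
rewrite IH.
have -> : @QForm F n.+1 c%:M = qf_osum (qf1 c) (@QForm F n c%:M).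
  by congr QForm; rewrite -scalar_mx_block.
by [].
Qed.

(** The similitude A of factor a, rescaled by a^-1, is an isometry between the multiples of <ac> and
    <c>. It does not involve c, so one N serves for all c. *)
Lemma sos_nsum a : a != 0 -> sos a ->
  exists N, forall c, qf_nsum N.+1 (qf1 (a * c)) ≃ qf_nsum N.+1 (qf1 c).
Proof.
move=> a0 /sos_similitude[[|N] [A [N0 AA1 AA2]]] //; exists N => c.
rewrite !qf_nsum_qf1; exists (a^-1 *: A), A^T; split => /=.
- by rewrite -scalemxAl AA1 scale_scalar_mx mulVf.
- by rewrite -scalemxAr AA2 scale_scalar_mx mulVf.
rewrite mul_mx_scalar [(_ *: A)^T]linearZ /= scalerA mulrAC mulfV // mul1r.
by rewrite -scalemxAr -scalemxAl AA2 !scale_scalar_mx mulrCA mulVf // mulr1.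
Qed.

End SumsOfSquares.

(** * Diagonalisation of symmetric matrices *)

Section Diagonalisation.
Variable F : fieldType.
Hypothesis F2 : (2%:R : F) != 0.
Local Notation "q1 ≃ q2" := (qf_iso q1 q2) (at level 70).

(** Polarisation: if all the vectors e_i + e_j are isotropic, the case i = j gives 4 T_ii = 0, and
    then 2 T_ij = 0. *)
Lemma sym_anisotropic_vector n (T : 'M[F]_n) : T^T = T -> T != 0 ->
  exists v : 'rV_n, (v *m T *m v^T) 0 0 != 0.
Proof.
move=> Ts T0; pose e i : 'rV[F]_n := delta_mx 0 i.
have eT i j : (e i *m T *m (e j)^T) 0 0 = T i j.
  by rewrite /e -rowE trmx_delta -colE !mxE.
have eeT i j : ((e i + e j) *m T *m (e i + e j)^T) 0 0 = T i i + T j j + T i j *+ 2.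
  have addE (A B : 'M[F]_1) : (A + B) 0 0 = A 0 0 + B 0 0 by rewrite mxE.
  rewrite linearD /= !mulmxDl !mulmxDr !addE !eT.
  by rewrite -[in T j i]Ts [T^T j i]mxE; ring.
have [/forallP z|/forallPn[i /forallPn[j nz]]] :=
  boolP [forall i, forall j, T i i + T j j + T i j *+ 2 == 0]; last first.
  by exists (e i + e j); rewrite eeT.
have z2 i j : T i i + T j j + T i j *+ 2 = 0 by apply/eqP; move/forallP: (z i).
have Tii i : T i i = 0.
  apply: (mulfI F2); apply: (mulfI F2); rewrite !mulr0 -(z2 i i); ring.
case/negP: T0; apply/eqP/matrixP=> i j; rewrite [RHS]mxE.
apply: (mulfI F2); rewrite mulr0 -(z2 i j) !Tii; ring.
Qed.

(** A vector v with value c != 0 is split off, its orthogonal complement being the kernel of T v^T.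
    That the diagonal entries are values of T is recorded because it is what later shows them to be
    sums of squares. *)
Lemma qf_diagonalisation n (T : 'M[F]_n) : T^T = T -> \det T != 0 ->
  exists cs : seq F, [/\ size cs = n, @QForm F n T ≃ qf_bigsum [seq qf1 c | c <- cs] &
    {in cs, forall c, c != 0 /\ exists v : 'rV_n, c = (v *m T *m v^T) 0 0}].
Proof.
elim: n T => [|n IH] T Ts dT.
  exists [::]; split=> //=; rewrite /qf_zero (_ : T = 0) //.
  by apply/matrixP; case.
have T0 : T != 0 by apply: contra_neq dT => ->; rewrite det0.
have [v v0] := sym_anisotropic_vector Ts T0; set c := _ 0 0 in v0.
have vTv : v *m T *m v^T = c%:M by apply: mx11_scalar.
have rk : \rank (kermx (T *m v^T)) = n.
  rewrite mxrank_ker; suff -> : \rank (T *m v^T) = 1%N by rewrite subn1.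
  apply/eqP; rewrite eqn_leq rank_leq_col lt0n mxrank_eq0.
  apply: contra_neq v0 => e; rewrite /c -mulmxA e mulmx0; exact: mxE.
have [B [fB BT]] : exists B : 'M_(n, n.+1), row_free B /\ B *m (T *m v^T) = 0.
  have := row_base_free (kermx (T *m v^T)).
  have : row_base (kermx (T *m v^T)) *m (T *m v^T) = 0.
    by apply/sub_kermxP; rewrite eq_row_base.
  by move: (row_base _); rewrite rk => B; exists B.
pose P : 'M_(1 + n, n.+1) := col_mx v B.
have uP : P \in unitmx.
  rewrite -row_free_unit -kermx_eq0; apply/rowV0P => u /sub_kermxP.
  rewrite -[u]hsubmxK mul_row_col => e.
  have /eqP : (lsubmx u *m v + rsubmx u *m B) *m (T *m v^T) = 0 by rewrite e mul0mx.
  rewrite mulmxDl -!mulmxA BT mulmx0 addr0 [v *m _]mulmxA vTv mul_mx_scalar scaler_eq0.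
  rewrite (negPf v0) /= => /eqP l0; move: e; rewrite l0 mul0mx add0r => e.
  by rewrite (row_free_inj fB (x1 := rsubmx u) (x2 := 0)) ?mul0mx // row_mx0.
have vTB : v *m T *m B^T = 0.
  by apply: trmx_inj; rewrite trmx0 !trmx_mul trmxK Ts.
have PTP : P *m T *m P^T = block_mx c%:M 0 0 (B *m T *m B^T).
  by rewrite /P mul_col_mx tr_col_mx mul_col_row vTv vTB -(mulmxA B) BT.
have [||cs [scs ics Pcs]] := IH (B *m T *m B^T).
- by rewrite !trmx_mul trmxK Ts mulmxA.
- have : \det (P *m T *m P^T) != 0.
    by rewrite !det_mulmx det_tr !mulf_neq0 // -unitfE -unitmxE.
  by rewrite PTP det_ublock mulf_eq0 negb_or => /andP[].
exists (c :: cs); split; first by rewrite /= scs.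
  rewrite /= -ics; exists P^T, (invmx P)^T; split.
  - by rewrite -trmx_mul mulVmx // trmx1.
  - by rewrite -trmx_mul mulmxV // trmx1.
  by rewrite trmxK PTP.
move=> d; rewrite inE => /orP[/eqP->|/Pcs[d0 [u du]]].
  by split=> //; exists v.
by split=> //; exists (u *m B); rewrite du trmx_mul !mulmxA.
Qed.

End Diagonalisation.

Lemma qf_bigsum_sos_nsum (F : fieldType) (cs : seq F) :
  {in cs, forall c, c != 0 /\ sos c} ->
  exists N, qf_iso (qf_nsum N.+1 (qf_bigsum [seq qf1 c | c <- cs]))
                   (qf_nsum (N.+1 * size cs) (qf1 1)).
Proof.
elim: cs => [|c cs IH] Pcs.
  exists 0%N; rewrite muln0; exact: qf_osum0.
have [N1 iN1] := IH (fun d dcs => Pcs d (mem_behead (s := c :: cs) dcs)).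
have [c0 sc] := Pcs c (mem_head _ _); have [N2 /(_ 1) iN2] := sos_nsum c0 sc.
rewrite mulr1 in iN2.
have h1 : qf_iso (qf_nsum (N1.+1 * N2.+1) (qf1 c)) (qf_nsum (N1.+1 * N2.+1) (qf1 1)).
  by rewrite !qf_nsumM (qf_nsum_iso _ iN2).
have h2 : qf_iso (qf_nsum (N2.+1 * N1.+1) (qf_bigsum [seq qf1 c | c <- cs]))
    (qf_nsum (N2.+1 * N1.+1 * size cs) (qf1 1)).
  by rewrite -mulnA !(qf_nsumM N2.+1) (qf_nsum_iso _ iN1).
exists (N1.+1 * N2.+1).-1; rewrite prednK // [qf_bigsum _]/= [size _]/=.
by rewrite qf_nsum_osum (mulnS _ (size cs)) qf_nsumD h1 [(N1.+1 * N2.+1)%N]mulnC h2.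
Qed.

(** * Springer's theorem and odd degree extensions *)

Section Springer.
Variables (F : fieldType) (n : nat) (c : 'I_n -> F).
Hypothesis c_aniso : forall x : 'I_n -> F,
  \sum_i c i * x i ^+ 2 = 0 -> forall i, x i = 0.

Lemma dvdp_biggcd (d : {poly F}) (r : 'I_n -> {poly F}) :
  (d %| \big[@gcdp F/0]_i r i) = [forall i, d %| r i].
Proof.
have -> : [forall i, d %| r i] = all (fun i => d %| r i) (index_enum 'I_n).
  by apply/forallP/allP => [dr i _|dr i]; last apply: dr; rewrite ?mem_index_enum.
elim: (index_enum _) => [|i s IH]; first by rewrite big_nil dvdp0.
by rewrite big_cons dvdp_gcd IH.
Qed.

(** The coefficient of degree 2d is the value of the form at the vector of coefficients of degree d,
    which is nonzero by anisotropy: leading terms cannot cancel. *)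
Lemma size_aniso (s : 'I_n -> {poly F}) (d : nat) :
  (forall i, size (s i) <= d.+1)%N -> (exists i, size (s i) = d.+1) ->
  size (\sum_i c i *: s i ^+ 2) = (d.*2).+1.
Proof.
move=> sd [i0 si0].
have cd (p : {poly F}) : (size p <= d.+1)%N -> (p ^+ 2)`_d.*2 = p`_d ^+ 2.
  move=> sp; rewrite [p ^+ 2]expr2 coefM -addnn.
  have dd : (d < (d + d).+1)%N by rewrite ltnS leq_addr.
  rewrite (bigD1 (Ordinal dd)) //= addnK big1 ?addr0 ?expr2 // => j jd.
  have := ltn_ord j; have : (j != d :> nat) by [].
  case: (ltngtP j d) => // jd' _ _.
    by rewrite [p`_(_ - j)]nth_default ?mulr0 // (leq_trans sp) //; lia.
  by rewrite [p`_j]nth_default ?mul0r // (leq_trans sp).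
apply/anti_leq/andP; split.
  apply: (leq_trans (size_sum _ _ _)); apply/bigmax_leqP => i _.
  apply: (leq_trans (size_scale_leq _ _)).
  apply: (leq_trans (size_exp_leq _ _)).
  by have := sd i; case: (size (s i)) => [|m]; lia.
rewrite ltnNge; apply/negP => /leq_sizeP/(_ _ (leqnn _)).
rewrite coef_sum; under eq_bigr => i _ do rewrite coefZ cd //.
move/c_aniso => /(_ i0) /eqP; apply/negP.
by rewrite -[d]/(d.+1.-1) -si0 -lead_coefE lead_coef_eq0 -size_poly_gt0 si0.
Qed.

(* Springer's descent: dividing [\sum_i c i *: s i ^+ 2], whose degree is even
   by anisotropy, by [f] of odd degree leaves a cofactor of smaller odd degree. *)
Lemma springer_descent (f : {poly F}) (g : 'I_n -> {poly F}) :
  f != 0 -> ~~ odd (size f) -> f %| \sum_i c i *: g i ^+ 2 ->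
  exists h : {poly F}, [/\ (1 < size h)%N, h %| f & forall i, h %| g i].
Proof.
have [m] := ubnP (size f); elim: m f g => // m IH f g sfm f0 sf fg.
pose r i := g i %% f.
have sfg : f %| \sum_i c i *: r i ^+ 2.
  rewrite -(dvdp_addr _ (m := \sum_i c i *: (g i ^+ 2 - r i ^+ 2))).
    rewrite -big_split /=; congr (_ %| _): fg; apply: eq_bigr => i _.
    by rewrite -scalerDr subrK.
  apply: (big_ind (fun p => f %| p)) => [|p q|i _]; first exact: dvdp0.
    exact: dvdp_add.
  rewrite dvdpZr ?subr_sqr; last first.
    apply/eqP => ci; have := @c_aniso (fun j => (j == i)%:R).
    rewrite (bigD1 i) //= ci mul0r big1 => [/(_ (addr0 _) i)/eqP|j /negPf->].
      by rewrite eqxx oner_eq0.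
    by rewrite expr0n mulr0.
  apply: dvdp_mulr; rewrite {1}(divp_eq (g i) f) addrK dvdp_mull //.
have sf1 : (1 < size f)%N.
  by have := sf; have := f0; rewrite -size_poly_gt0; case: (size f) => [|[]].
have [r0|/forallPn[i0 ri0]] := boolP [forall i, r i == 0].
  exists f; split=> // i; apply/modp_eq0P; exact/eqP/(forallP r0).
pose d := \big[@gcdp F/0]_i r i.
have dr i : d %| r i by have := dvdpp d; rewrite {2}/d dvdp_biggcd => /forallP.
have d0 : d != 0 by apply: contra_neq ri0 => d0; apply/eqP; rewrite -dvd0p -d0.
have hfg h : h %| d -> h %| f -> forall i, h %| g i.
  move=> hd hf i; rewrite (divp_eq (g i) f) dvdp_add ?dvdp_mull //.
  exact: dvdp_trans hd (dr i).
have [cp|ncp] := boolP (coprimep f d); last first.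
  exists (gcdp f d); rewrite dvdp_gcdl; split=> //.
    have : (0 < size (gcdp f d))%N by rewrite size_poly_gt0 gcdp_eq0 negb_and f0.
    by move: ncp; rewrite /coprimep; case: (size _) => [|[]].
  by apply: hfg; [exact: dvdp_gcdr | exact: dvdp_gcdl].
(* Division by d, which is coprime to f, preserves divisibility by f and leaves the s_i without
   common factor, so that the induction hypothesis will be contradicted. *)
pose s i := r i %/ d.
have rs i : r i = s i * d by rewrite divpK.
have fs : f %| \sum_i c i *: s i ^+ 2.
  rewrite -(Gauss_dvdpl _ (q := d ^+ 2)) ?coprimep_expr //.
  rewrite mulr_suml; congr (_ %| _): sfg; apply: eq_bigr => i _.
  by rewrite rs exprMn scalerAl.
have s_d i : (size (s i) < size f)%N.
  have r_f : (size (r i) < size f)%N by rewrite ltn_modp.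
  by apply: leq_ltn_trans r_f; rewrite size_divp // leq_subr.
have si0 : s i0 != 0 by apply: contra_neq ri0 => e; rewrite rs e mul0r.
have [i1 _ maxi] := @arg_maxnP _ i0 xpredT (fun i => size (s i)) isT.
case e1 : (size (s i1)) => [|e].
  by have := maxi i0 isT; rewrite /= e1 leqn0 size_poly_eq0 (negPf si0).
have ss : size (\sum_i c i *: s i ^+ 2) = (e.*2).+1.
  by apply: size_aniso => [i|]; [rewrite -e1; exact: maxi | exists i1].
have [q qE] := dvdpP _ _ fs; rewrite qE in ss.
have q0 : q != 0 by apply/eqP => q0; move: ss; rewrite q0 mul0r size_poly0.
have sq : (size q + size f = (e.*2).+2)%N.
  move: ss; rewrite size_mul // => ss; rewrite -(prednK (n := _ + _)) ?ss //.
  by rewrite addn_gt0 (ltnW sf1) orbT.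
have sef : (e.+1 < size f)%N by rewrite -e1.
(* The cofactor q is smaller than f because the sizes add up to 2e + 2 while e + 1 is less than the
   size of f; the same sum shows that the size of q is even. *)
have [||||h [h1 hq hs]] := IH q s.
- by move: sfm sq sef; rewrite -addnn; lia.
- by [].
- have : odd (size q + size f) = false by rewrite sq /= odd_double.
  by rewrite oddD (negPf sf) addbF => ->.
- by rewrite qE dvdp_mulr.
(* A common divisor h of the s_i makes h * d a common divisor of the r_i, whose gcd is d. *)
have : h * d %| d.
  by rewrite {2}/d dvdp_biggcd; apply/forallP=> i; rewrite rs dvdp_mul2r.
rewrite -{2}[d]mul1r dvdp_mul2r // dvdp1 => /eqP sh.
by rewrite sh in h1.
Qed.

End Springer.

Section OddDegree.
Variables (k : fieldType) (L : splittingFieldType k).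
Hypothesis k2 : (2%:R : k) != 0.
Local Notation "q1 ≃ q2" := (qf_iso q1 q2) (at level 70).

Lemma char_ext (F : fieldExtType k) : (2%:R : F) != 0.
Proof. by rewrite -(rmorph_nat (in_alg F)) fmorph_eq0. Qed.

(** A zero with x_0 != 0 writes a as a sum of squares. A nontrivial zero with x_0 = 0 writes -1 as
    one, and then every a is a sum of squares, being a difference of two squares. *)
Lemma sos_aniso (F : fieldExtType k) (a : F) n : ~ sos a ->
  forall x : 'I_n.+1 -> F,
  \sum_i (if i == ord0 then - a else 1) * x i ^+ 2 = 0 -> forall i, x i = 0.
Proof.
move=> nsa x.
have F2 := char_ext F.
rewrite big_ord_recl eqxx; under eq_bigr => i _ do rewrite mul1r.
move=> e; have x0 : x ord0 = 0.
  apply/eqP; apply/negPn/negP => x0; apply: nsa.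
  exists [seq x (lift ord0 i) / x ord0 | i <- enum 'I_n].
  rewrite big_map big_enum; under eq_bigr => i _ do rewrite expr_div_n.
  rewrite -mulr_suml.
  have -> : \sum_(i < n) x (lift ord0 i) ^+ 2 = a * x ord0 ^+ 2.
    by apply/eqP; rewrite -subr_eq0 addrC -mulNr e.
  by rewrite mulfK // expf_neq0.
rewrite x0 expr0n mulr0 add0r in e.
move=> i; case: (unliftP ord0 i) => [j ->|->] //.
apply/eqP; apply/negPn/negP => xj; apply: nsa.
have sN1 : sos (-1 : F).
  exists [seq x (lift ord0 i) / x (lift ord0 j) | i <- enum 'I_n & i != j].
  rewrite big_map big_filter big_enum_cond /=.
  under eq_bigr => l _ do rewrite expr_div_n.
  rewrite -mulr_suml.
  move: e; rewrite (bigD1 j) //= => /eqP; rewrite addrC addr_eq0 => /eqP ->.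
  by rewrite mulNr mulfV // expf_neq0.
have -> : a = ((a + 1) / 2%:R) ^+ 2 + (-1) * ((a - 1) / 2%:R) ^+ 2 by field.
by apply: sosD; [apply: sosX2 | apply: sosM; [|apply: sosX2]].
Qed.

(** Let f be the minimal polynomial of a primitive element x and y_j = G_j(x). Then f, of odd
    degree, divides - a + sum of the G_j^2. If <-a> + n<1> were anisotropic over K, Springer's
    descent would give a nonconstant common factor of the G_j and of the entry 1 multiplying -a. *)
Lemma sos_odd_descent (K : {subfield L}) (a : subvs_of K) (ys : seq L) :
  galois K {:L} -> odd (\dim_K {:L}) ->
  vsval a = \sum_(y <- ys) y ^+ 2 -> sos a.
Proof.
move=> galK oddK ea; apply: NNPP => nsa.
have [sK sepK _] := and3P galK.
pose x := separable_generator K {:L}.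
have Kx : {:L}%VS = <<K; x>>%VS by apply: eq_adjoin_separable_generator.
have [f fE] := polyOver_subvs (minPolyOver K x).
have /all_sig[G GE] y : {g : {poly subvs_of K} | y = (map_poly vsval g).[x]}.
  have yx : y \in <<K; x>>%VS by rewrite -Kx memvf.
  have /sig_eqW[g gE] := polyOver_subvs (Fadjoin_polyOver K x y).
  by exists g; rewrite -gE Fadjoin_poly_eq.
pose n := size ys.
pose g (i : 'I_n.+1) : {poly subvs_of K} :=
  if unlift ord0 i is Some j then G ys`_j else 1.
have [||| h [h1 _ hg]] := @springer_descent _ _ _ (sos_aniso (n := n) nsa) f g.
- apply/eqP => f0; have := monic_neq0 (monic_minPoly K x).
  by rewrite fE f0 rmorph0 eqxx.
- rewrite -(size_map_poly vsval) -fE size_minPoly adjoin_degreeE -Kx /=.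
  by rewrite negbK.
- rewrite -(dvdp_map vsval) -fE; apply: minPoly_dvdp.
    by apply/polyOver_subvs; eexists.
  rewrite /root big_ord_recl eqxx /g unlift_none expr1n.
  under eq_bigr => i _ do rewrite liftK /= scale1r.
  rewrite rmorphD rmorph_sum /= hornerD horner_sum.
  under eq_bigr => i _ do rewrite rmorphXn /= horner_exp -GE.
  rewrite map_polyZ rmorph1 hornerZ hornerC mulr1 rmorphN /= ea.
  by rewrite (big_nth 0) big_mkord addNr.
have := hg ord0; rewrite /g unlift_none dvdp1 => /eqP sh.
by rewrite sh in h1.
Qed.

(** In a basis w of L over K = L^H the Gram matrix of the trace form is U^T U, where U has entries
    s(w_j) for s in H. A value v U^T U v^T is thus the sum of the squares of the entries of v U^T,
    which lie in L; odd degree moves this down to K. *)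
Lemma nsum_trace_form_odd (H : {group gal_of {:L}}) : odd #|H| ->
  exists N, qf_nsum N.+1 (trace_form {:L})
    ≃ qf_nsum (N.+1 * #|H|) (trace_form (fixedField H)).
Proof.
move=> oddH; set K := fixedField_aspace H.
have [w [wL _] [uU _ /(_ (groupP H)) sumw]] := gal_matrix H.
set n := #|H| in w wL uU sumw *; set U := \matrix_(i, j) _ in uU.
pose sg (s : 'I_n) : gal_of {:L} := enum_val s.
(* The coordinates in w: applying all s in H to an expansion in w gives a linear system with matrix
   U. *)
pose p i x := \sum_s invmx U i s * sg s x.
have pl i : {in K, forall a x y, p i (a * x + y) = a * p i x + p i y}.
  move=> a aK x y; rewrite mulr_sumr -big_split /=; apply: eq_bigr => s _.
  rewrite rmorphD rmorphM /= mulrDr (_ : sg s a = a); first by ring.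
  by have /fixedFieldP := aK; apply; rewrite ?memvf ?(enum_valP s).
have pw i j : p i (tnth w j) = (i == j)%:R.
  have := congr1 (fun A : 'M_n => A i j) (mulVmx uU); rewrite !mxE => <-.
  by apply: eq_bigr => s _; rewrite mxE.
have p_sum i (y : 'I_n -> L) : (forall j, y j \in K) ->
    p i (\sum_j y j * tnth w j) = y i.
  move=> yK; have p0 : p i 0 = 0.
    by rewrite /p big1 // => s _; rewrite rmorph0 mulr0.
  transitivity (\sum_j y j * p i (tnth w j)).
    by elim/big_rec2: _ => // j a b _ <-; apply: pl.
  rewrite (bigD1 i) //= pw eqxx mulr1 big1 ?addr0 // => j /negPf ji.
  by rewrite pw eq_sym ji mulr0.
have coord x : exists2 y : 'I_n -> L, forall j, y j \in K &
    x = \sum_j y j * tnth w j.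
  have : x \in (\sum_i K * <[tnth w i]>)%VS by rewrite sumw memvf.
  case/memv_sumP=> v vP ->.
  have /fin_all_exists2[y yK vE] j : exists2 u, u \in K & v j = u * tnth w j.
    exact/memv_cosetP/vP.
  by exists y => //; apply: eq_bigr.
have pK i : {in {:L}%VS, forall x, p i x \in K}.
  by move=> x _; have [y yK ->] := coord x; rewrite p_sum.
have pP : {in {:L}%VS, forall x, x = \sum_i p i x * tnth w i}.
  move=> x _; have [y yK xE] := coord x; rewrite [LHS]xE.
  by apply: eq_bigr => i _; rewrite xE p_sum.
have tr_p x : \sum_l p l (x * tnth w l) = \sum_s sg s x.
  transitivity (\sum_s sg s x * (U *m invmx U) s s).
    rewrite exchange_big; apply: eq_bigr => s _ /=.
    rewrite mxE mulr_sumr; apply: eq_bigr => l _.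
    by rewrite rmorphM mxE; ring.
  by rewrite mulmxV //; apply: eq_bigr => s _; rewrite mxE eqxx mulr1.
pose M := \matrix_(i, j) vsproj K ((U^T *m U) i j).
have UUE i j : (U^T *m U) i j = \sum_s sg s (tnth w i * tnth w j).
  by rewrite mxE; apply: eq_bigr => s _; rewrite !mxE rmorphM.
have ME i j : vsval (M i j) = (U^T *m U) i j.
  by rewrite mxE vsprojK // UUE -tr_p rpred_sum // => l _; rewrite pK ?memvf.
have mapM : map_mx vsval M = U^T *m U.
  by apply/matrixP=> i j; rewrite mxE ME.
have MT : M^T = M.
  by apply/matrixP=> i j; apply: val_inj; rewrite /= mxE !ME !UUE mulrC.
have dM : \det M != 0.
  rewrite -(fmorph_eq0 (vsval : {rmorphism subvs_of K -> L})) -det_map_mx /= mapM.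
  by rewrite det_mulmx det_tr mulf_neq0 // -unitfE -unitmxE.
have trL : trace_form {:L} ≃ qf_transfer (@tr_sub k L K) (@QForm _ n M).
  rewrite trace_form_tf; apply: (tf_gram (w := tnth w) (p := p)) => //.
  - exact: subvf.
  - by move=> i; rewrite memvf.
  - exact: memvf.
  by move=> i j; rewrite ME tr_p mul1r UUE.
have [cs [scs iM Pcs]] := qf_diagonalisation (char_ext _) MT dM.
have [|N iN] := @qf_bigsum_sos_nsum (subvs_of K) cs.
  move=> c /Pcs[c0 [v cE]]; split=> //.
  pose v' := map_mx vsval v.
  apply: (@sos_odd_descent K c [seq (v' *m U^T) 0 s | s <- enum 'I_n]).
  - exact: fixedField_galois.
  - by rewrite -dim_fixedField.
  rewrite big_map big_enum /= cE.
  have -> : vsval ((v *m M *m v^T) 0 0) = (map_mx vsval (v *m M *m v^T)) 0 0.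
    by rewrite [RHS]mxE.
  rewrite !map_mxM -map_trmx mapM -/v' mulmxA -mulmxA -{2}[U]trmxK -trmx_mul mxE.
  by apply: eq_bigr => s _; rewrite [X in _ * X]mxE expr2.
have trK : trace_form K ≃ qf_transfer (@tr_sub k L K) (qf1 1).
  by rewrite trace_form_tf -tf_transfer rmorph1.
exists N; rewrite (qf_nsum_iso _ trL) (qf_nsum_iso _ trK).
rewrite -!(qf_transfer_nsum (@tr_sub_scalar k L K)).
by apply: (qf_transfer_iso (@tr_sub_scalar k L K)); rewrite (qf_nsum_iso _ iM) -scs.
Qed.
End OddDegree.

(** * Trace forms of quadratic and biquadratic extensions *)

Section Multiples.
Variable k : fieldType.
Local Notation "q1 ≃ q2" := (qf_iso q1 q2) (at level 70).
Local Notation "q1 ⊥ q2" := (qf_osum q1 q2) (at level 50, left associativity).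

Lemma qf_nsum_osum_same (q1 q2 r : qform k) N1 N2 :
  qf_nsum N1.+1 q1 ≃ qf_nsum N1.+1 r -> qf_nsum N2.+1 q2 ≃ qf_nsum N2.+1 r ->
  exists N, qf_nsum N.+1 (q1 ⊥ q2) ≃ qf_nsum (N.+1 * 2) r.
Proof.
move=> i1 i2; exists (N1.+1 * N2.+1).-1; rewrite prednK // qf_nsum_osum.
rewrite muln2 -addnn qf_nsumD; apply: qf_osum_iso.
  by rewrite mulnC !qf_nsumM i1.
by rewrite !qf_nsumM i2.
Qed.

(** Here [q2a] stands for <2a>, [q4a] for <4a> and so on, with the letter c for the product ab. Once
    the factors 2 and 4 are absorbed, both sides are multiples of 3<1> + <a> + <b> + <ab>. *)
Lemma qf_nsum_biquadratic N (q1 qa qb qc q2 q2a q2b q2c q4 q4a q4b q4c : qform k) :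
  let n q := qf_nsum N q in
  n q2 ≃ n q1 -> n q2a ≃ n qa -> n q2b ≃ n qb -> n q2c ≃ n qc ->
  n q4 ≃ n q2 -> n q4a ≃ n q2a -> n q4b ≃ n q2b -> n q4c ≃ n q2c ->
  n (q4 ⊥ q4a ⊥ (q4b ⊥ q4c) ⊥ qf_nsum 2 q1) ≃
  n (q2 ⊥ q2a ⊥ (q2 ⊥ q2b) ⊥ (q2 ⊥ q2c)).
Proof.
move=> n i1 ia ib ic j1 ja jb jc; have e2 : qf_nsum 2 q1 ≃ q1 ⊥ q1 by rewrite /= qf_osum0.
rewrite /n e2 !qf_nsum_osum -!/(n _).
rewrite j1 ja jb jc i1 ia ib ic.
move: (n q1) (n qa) (n qb) (n qc) => r1 ra rb rc.
by rewrite -(qf_osumA (r1 ⊥ ra)) -(qf_osumA (r1 ⊥ ra)) (qf_osumACA r1 rb)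
  (qf_osumC (r1 ⊥ r1)).
Qed.

End Multiples.

Section Quadratic.
Variables (k : fieldType) (L : splittingFieldType k).
Hypothesis k2 : (2%:R : k) != 0.
Local Notation "q1 ≃ q2" := (qf_iso q1 q2) (at level 70).
Local Notation "q1 ⊥ q2" := (qf_osum q1 q2) (at level 50, left associativity).

Lemma trace_form_tf1 (K : {subfield L}) (U : {vspace L}) :
  trace_form U = tf U (vsval (1 : subvs_of K)).
Proof. by rewrite trace_form_tf rmorph1. Qed.

(** In the basis 1, t of E / K the form tr_{E/K}(c x y) is diagonal, since t has trace 0; its
    entries are 2c and 2c t^2. The automorphism g of L restricts to the conjugation of E / K, and
    [p] takes even and odd parts under it. *)
Lemma tf_quadratic (K E : {subfield L}) (g : gal_of {:L}) (t : L) (c d : subvs_of K) :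
  (K <= E)%VS -> {in K, forall a, g a = a} -> {in E, forall x, x + g x \in K} ->
  t \in E -> t != 0 -> g t = - t -> vsval d = t ^+ 2 ->
  tf E (vsval c) ≃ tf K (vsval (2%:R * c)) ⊥ tf K (vsval (2%:R * c * d)).
Proof.
move=> sKE gK gE tE t0 gt dt; have L2 := char_ext k2 L.
pose w (i : 'I_(1 + 1)) : L := if i == ord0 then 1 else t.
pose p (i : 'I_(1 + 1)) (x : L) : L :=
  if i == ord0 then (x + g x) / 2%:R else (x - g x) / (2%:R * t).
have ggE : {in E, forall x, g (g x) = x}.
  by move=> x xE; have /gK := gE x xE; rewrite rmorphD addrC => /addIr.
have K2 : (2%:R : L) \in K by rewrite rpred_nat.
have p0K : {in E, forall x, (x + g x) / 2%:R \in K}.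
  by move=> x xE; rewrite rpred_div // gE.
(* The quotient is fixed by g, hence equals half its own trace, and traces lie in K. *)
have p1K : {in E, forall x, (x - g x) / (2%:R * t) \in K}.
  move=> x xE; set y := _ / _.
  have yE : y \in E.
    have gxE : g x \in E.
      by rewrite -(addrK x (g x)) addrC rpredD ?rpredN // addrC (subvP sKE) ?gE.
    by rewrite rpred_div ?rpredB ?rpredM // rpred_nat.
  have gy : g y = y.
    rewrite /y fmorph_div rmorphB rmorphM rmorph_nat /= ggE // gt; field.
    by rewrite oppr_eq0 t0 L2.
  by have := p0K y yE; rewrite gy -mulr2n -[y *+ 2]mulr_natr mulfK.
have lift1 : lift ord0 (ord0 : 'I_1) != ord0 :> 'I_(1 + 1) by [].
have lift1' : (ord0 == lift ord0 ord0 :> 'I_(1 + 1)) = false by [].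
have psum x : \sum_l p l (x * w l) = x + g x.
  rewrite big_ord_recl big_ord1 /p /w !eqxx (negPf lift1) mulr1 rmorphM /= gt.
  by field; rewrite t0 L2.
have cK := valP c; have gc : g (vsval c) = vsval c by apply: gK.
pose M := @block_mx _ 1 1 1 1 (2%:R * c)%:M 0 0 (2%:R * c * d)%:M.
have -> : tf E (vsval c) ≃ qf_transfer (@tr_sub k L K) (@QForm _ (1 + 1) M).
  apply: (@tf_gram k L K E (1 + 1) w p) => //.
  - by move=> i; rewrite /w; case: ifP => // _; apply: rpred1.
  - by move=> i x xE; rewrite /p; case: ifP => _; [apply: p0K | apply: p1K].
  - move=> x xE; rewrite big_ord_recl big_ord1 /p /w !eqxx (negPf lift1).
    by field; rewrite t0 L2.
  - move=> i a aK x y; rewrite /p; case: ifP => _; rewrite rmorphD rmorphM /= gK //;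
    by field; rewrite ?t0 ?L2.
  - have ord2 (i : 'I_(1 + 1)) : i = ord0 \/ i = lift ord0 ord0.
      by case: (unliftP ord0 i) => [j|] ->; [right; rewrite (ord1 j)|left].
    move=> i j; case: (ord2 i) => ->; case: (ord2 j) => ->;
      rewrite /p /w ?eqxx ?(negPf lift1) ?lift1' ?mulr0n ?mulr1n ?rmorph1 ?gt;
      by field; rewrite ?t0 ?L2.
  - exact: (subvP sKE).
  - have M2 : vsval (2%:R * c) = 2%:R * vsval c by rewrite rmorphM rmorph_nat.
    have M2d : vsval (2%:R * c * d) = 2%:R * vsval c * t ^+ 2.
      by rewrite !rmorphM rmorph_nat /= dt.
    move=> i j; rewrite psum /M.
    have w0 : w (lshift 1 ord0) = 1 by [].
    have w1 : w (rshift 1 ord0) = t by [].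
    case: (split_ordP i) => i' ->; case: (split_ordP j) => j' ->;
      rewrite (ord1 i') (ord1 j') ?(block_mxEul, block_mxEur, block_mxEdl, block_mxEdr);
      rewrite mxE ?w0 ?w1 ?rmorph0 ?eqxx ?mulr1n ?M2 ?M2d;
      rewrite !rmorphM ?rmorph1 /= ?gc ?gt; ring.
apply: (qf_iso_trans (qf_transfer_osum (@tr_sub_scalar k L K) (qf1 (2%:R * c))
  (qf1 (2%:R * c * d)))).
by apply: qf_osum_iso; apply: qf_iso_sym; apply: tf_transfer.
Qed.

Lemma nsum_tf_transfer n (K : {subfield L}) (c : subvs_of K) :
  qf_nsum n (tf K (vsval c)) ≃ qf_transfer (@tr_sub k L K) (qf_nsum n (qf1 c)).
Proof.
apply: qf_iso_trans (qf_nsum_iso n (tf_transfer c)) _.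
by apply: qf_iso_sym; apply: (qf_transfer_nsum (@tr_sub_scalar k L K)).
Qed.

Lemma tf_sos_nsum (K : {subfield L}) (a : subvs_of K) : a != 0 -> sos a ->
  exists N, forall c, qf_nsum N.+1 (tf K (vsval (a * c))) ≃ qf_nsum N.+1 (tf K (vsval c)).
Proof.
move=> a0 /(sos_nsum a0)[N iN]; exists N => c.
apply: qf_iso_trans (nsum_tf_transfer _ _) _.
apply: qf_iso_trans (qf_iso_sym (nsum_tf_transfer _ _)).
exact: (qf_transfer_iso (@tr_sub_scalar k L K)).
Qed.

Lemma sos_nat (F : fieldType) n : sos (n%:R : F).
Proof. by apply: sosMn; rewrite -(expr1n F 2); apply: sosX2. Qed.

(** The trace form of E descends to <2, 2d> over K, and both 2 and 2d are sums of squares there. *)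
Lemma nsum_trace_form_quadratic (K E : {subfield L}) (g : gal_of {:L}) t (d : subvs_of K) :
  (K <= E)%VS -> {in K, forall a, g a = a} -> {in E, forall x, x + g x \in K} ->
  t \in E -> t != 0 -> g t = - t -> vsval d = t ^+ 2 -> sos d ->
  exists N, qf_nsum N.+1 (trace_form E) ≃ qf_nsum (N.+1 * 2) (trace_form K).
Proof.
move=> sKE gK gE tE t0 gt dt sd.
have F2 := char_ext k2 (subvs_of K).
have d0 : d != 0.
  by apply: contra_neq t0 => d0; apply/eqP; rewrite -sqrf_eq0 -dt d0 rmorph0.
have [N1 /(_ 1) i1] := tf_sos_nsum F2 (sos_nat _ 2).
have [N2 /(_ 1) i2] := tf_sos_nsum (mulf_neq0 F2 d0) (sosM (sos_nat _ 2) sd).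
have q := tf_quadratic 1 sKE gK gE tE t0 gt dt.
rewrite -(trace_form_tf1 K) mulrAC in q.
have [N iN] := qf_nsum_osum_same i1 i2.
exists N; rewrite (trace_form_tf1 K K); exact: qf_iso_trans (qf_nsum_iso _ q) iN.
Qed.

(* With [a = s ^+ 2] and [b = t ^+ 2], the forms to compare are
   [4<1, a, b, ab>] + [2<1>] and [2<1, a>] + [2<1, b>] + [2<1, ab>],
   which agree after a multiplication that absorbs the factor 2. *)
Lemma nsum_trace_form_biquadratic (K A B C M : {subfield L}) (g h : gal_of {:L}) s t
    (a b : subvs_of K) :
  (K <= A)%VS -> (K <= B)%VS -> (K <= C)%VS -> (A <= M)%VS ->
  {in A, forall x, g x = x} -> {in B, forall x, h x = x} ->
  {in M, forall x, x + g x \in A} -> {in A, forall x, x + h x \in K} ->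
  {in B, forall x, x + g x \in K} -> {in C, forall x, x + g x \in K} ->
  [/\ s \in A, s != 0 & h s = - s] -> [/\ t \in B, t \in M, t != 0 & g t = - t] ->
  s * t \in C ->
  vsval a = s ^+ 2 -> vsval b = t ^+ 2 ->
  exists N, qf_nsum N.+1 (trace_form M ⊥ qf_nsum 2 (trace_form K)) ≃
    qf_nsum N.+1 (trace_form A ⊥ trace_form B ⊥ trace_form C).
Proof.
move=> sKA sKB sKC sAM gA hB gM hA gB gC [sA s0 hs] [tB tM t0 gt] stC sa tb.
have F2 := char_ext k2 (subvs_of K).
have [N iN] := tf_sos_nsum F2 (sos_nat _ 2).
have gK : {in K, forall x, g x = x} by move=> x /(subvP sKA); apply: gA.
have hK : {in K, forall x, h x = x} by move=> x /(subvP sKB); apply: hB.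
have gs : g s = s by apply: gA.
have qA : trace_form A ≃ tf K (vsval (2%:R * 1 : subvs_of K)) ⊥ tf K (vsval (2%:R * 1 * a)).
  by rewrite (trace_form_tf1 K); apply: (tf_quadratic (g := h) (t := s)).
have qB : trace_form B ≃ tf K (vsval (2%:R * 1 : subvs_of K)) ⊥ tf K (vsval (2%:R * 1 * b)).
  by rewrite (trace_form_tf1 K); apply: (tf_quadratic (g := g) (t := t)).
have qC : trace_form C ≃
    tf K (vsval (2%:R * 1 : subvs_of K)) ⊥ tf K (vsval (2%:R * 1 * (a * b))).
  rewrite (trace_form_tf1 K); apply: (tf_quadratic (g := g) (t := s * t)) => //.
  - by rewrite mulf_neq0.
  - by rewrite rmorphM /= gs gt mulrN.
  by rewrite rmorphM /= sa tb exprMn.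
have sub (c : subvs_of K) : vsval c \in A by rewrite (subvP sKA) ?(valP c).
(* The descent has two steps: M / A is generated by t with conjugation g, then A / K by s with
   conjugation h. *)
have qM : trace_form M ≃
    tf K (vsval (2%:R * (2%:R * 1) : subvs_of K)) ⊥ tf K (vsval (2%:R * (2%:R * 1) * a))
    ⊥ (tf K (vsval (2%:R * (2%:R * b))) ⊥ tf K (vsval (2%:R * (2%:R * b) * a))).
  pose bA := vsproj A (vsval b).
  have -> : trace_form M ≃ tf A (vsval (2%:R * 1 : subvs_of A)) ⊥ tf A (vsval (2%:R * 1 * bA)).
    rewrite (trace_form_tf1 A); apply: (tf_quadratic (g := g) (t := t)) => //.
    by rewrite vsprojK.
  have -> : vsval (2%:R * 1 : subvs_of A) = vsval (2%:R * 1 : subvs_of K).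
    by rewrite !rmorphM !rmorph_nat !rmorph1.
  have -> : vsval (2%:R * 1 * bA) = vsval (2%:R * b).
    by rewrite !rmorphM !rmorph_nat !rmorph1 mulr1 /= vsprojK.
  by apply: qf_osum_iso; apply: (tf_quadratic (g := h) (t := s)).
have N2 (c : subvs_of K) : qf_nsum N.+1 (tf K (vsval (2%:R * 1 * c))) ≃
    qf_nsum N.+1 (tf K (vsval c)).
  by rewrite mulr1; apply: iN.
have N4 (c : subvs_of K) : qf_nsum N.+1 (tf K (vsval (2%:R * (2%:R * 1) * c))) ≃
    qf_nsum N.+1 (tf K (vsval (2%:R * 1 * c))).
  by rewrite -(mulrA 2%:R (2%:R * 1)); apply: iN.
exists N.
have q2K : qf_nsum 2 (trace_form K) ≃ qf_nsum 2 (tf K (vsval (1 : subvs_of K))).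
  by rewrite (trace_form_tf1 K).
apply: qf_iso_trans (qf_nsum_iso _ (qf_osum_iso qM q2K)) _.
apply: qf_iso_trans
  (qf_iso_sym (qf_nsum_iso _ (qf_osum_iso (qf_osum_iso qA qB) qC))).
apply: (qf_nsum_biquadratic (N := N.+1) (iN 1) (N2 a) (N2 b) (N2 (a * b)) (iN _) (N4 a)).
  by rewrite mulr1; apply: iN.
by rewrite (mulrC a b) mulr1 -!mulrA; apply: iN.
Qed.

End Quadratic.

(** * The Dress map *)

Section DressMap.
Variables (k : fieldType) (L : splittingFieldType k).
Implicit Types (H : {group gal_of {:L}}) (C : {set {group gal_of {:L}}}).
Local Notation "q1 ≃ q2" := (qf_iso q1 q2) (at level 70).
Local Notation "q1 ⊥ q2" := (qf_osum q1 q2) (at level 50, left associativity).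
Local Notation form H := (trace_form (fixedField (H : {set gal_of {:L}}))).

Lemma mem_GalG (x : gal_of {:L}) : x \in GalG L.
Proof.
rewrite gal_kHom ?sub1v //; apply/kAHomP => u /vlineP[c ->].
by rewrite linearZ /= rmorph1.
Qed.

Lemma galVK (x : gal_of {:L}) : cancel x (x^-1)%g.
Proof. by move=> a; rewrite -galM ?memvf // mulgV gal_id. Qed.

Lemma galKV (x : gal_of {:L}) : cancel (x^-1)%g x.
Proof. by move=> a; rewrite -galM ?memvf // mulVg gal_id. Qed.

(** An automorphism carries a basis of E to a basis of E' and respects products, so it preserves
    traces. *)
Lemma trace_form_gal (x : gal_of {:L}) (E E' : {subfield L}) :
  (forall a, (a \in E) = (x a \in E')) -> trace_form E ≃ trace_form E'.
Proof.
move=> EE'.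
have E'E a : (a \in E') = ((x^-1)%g a \in E) by rewrite EE' galKV.
have tr a : a \in E -> ftrace E' (x a) = ftrace E a.
  move=> aE; rewrite /ftrace (trace_indep (U := E') (J := 'I_(\dim E))
    (v := fun i : 'I_(\dim E') => (vbasis E')`_i) (c := fun i y => coord (vbasis E') i y)
    (v' := fun j : 'I_(\dim E) => x (vbasis E)`_j)
    (c' := fun j y => coord (vbasis E) j ((x^-1)%g y)) (u := fun y => x a * y)).
  - by apply: eq_bigr => j _; rewrite -rmorphM /= galVK.
  - by move=> i b y z; rewrite linearP.
  - by move=> i; apply: vbasis_mem; rewrite mem_nth ?size_tuple.
  - by move=> y yE; rewrite {1}(coord_vbasis yE).
  - by move=> i b y z; rewrite linearP linearP.
  - by move=> j; rewrite -EE'; apply: vbasis_mem; rewrite mem_nth ?size_tuple.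
  - move=> y; rewrite E'E => yE; rewrite -{1}(galKV x y) {1}(coord_vbasis yE) linear_sum.
    by apply: eq_bigr => j _; rewrite linearZ.
  - by move=> b y z; rewrite mulrDr scalerAr.
  - by move=> y yE; rewrite rpredM // -EE'.
rewrite !trace_form_tf.
apply: models_iso (tf_models E 1) _.
apply: (@models_isom _ _ _ _ _ (fun y : subvs_of E => vsproj E' (x (vsval y)))
  (fun y : subvs_of E' => vsproj E ((x^-1)%g (vsval y)))) (tf_models E' 1).
- by move=> b y z; rewrite !linearP.
- move=> y; apply: val_inj; rewrite /= [vsval (vsproj E' _)]vsprojK -?EE' ?(valP y) //.
  by rewrite galVK vsprojK ?(valP y).
- move=> y; apply: val_inj; rewrite /= [vsval (vsproj E _)]vsprojK -?E'E ?(valP y) //.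
  by rewrite galKV vsprojK ?(valP y).
move=> y z; rewrite !mul1r !vsprojK -?EE' ?(valP y) ?(valP z) //.
by rewrite -[x _ * x _]rmorphM /= tr // rpredM ?(valP y) ?(valP z).
Qed.

(** The fixed field of the conjugate is the image under x of the fixed field of [H]. This makes
    [dress_basis] independent of the representative picked in a class. *)
Lemma form_conj H (x : gal_of {:L}) : form H ≃ form (H :^ x)%G.
Proof.
apply: (@trace_form_gal x (fixedField_aspace H) (fixedField_aspace (H :^ x)%G)) => a.
apply/fixedFieldP/fixedFieldP; rewrite ?memvf // => fa.
  move=> y /imsetP[h hH ->]; rewrite conjgE !galM ?memvf // galVK; congr (x _).
  exact: fa.
move=> h hH; apply: (can_inj (galVK x)).
have := fa (h ^ x)%g; rewrite memJ_conjg => /(_ hH).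
by rewrite conjgE !galM ?memvf // galVK.
Qed.

Definition gclass H := orbit 'JG%act (GalG L) H.

Lemma dress_basis_gclass H : dress_basis (gclass H) ≃ form H.
Proof.
rewrite /dress_basis /class_rep; case: pickP => [H' /=|/(_ H)]; last first.
  by rewrite orbit_refl.
by case/orbitP=> x _ <-; apply: qf_iso_sym; apply: form_conj.
Qed.

Lemma gclass_subgroup H : gclass H \in subgroup_classes L.
Proof.
apply/imsetP; exists H => //; rewrite inE; apply/subsetP=> x _; exact: mem_GalG.
Qed.

Lemma gclass_card H H' : gclass H = gclass H' -> #|H| = #|H'|.
Proof.
move=> e; have : H \in gclass H' by rewrite -e orbit_refl.
by case/orbitP=> x _ <-; rewrite /= cardJg.
Qed.

Lemma qf_bigsum_incr (T : eqType) (B : T -> qform k) (f : T -> nat) r x0 :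
  uniq r -> x0 \in r ->
  qf_bigsum [seq qf_nsum ((x0 == x) + f x)%N (B x) | x <- r] ≃
  B x0 ⊥ qf_bigsum [seq qf_nsum (f x) (B x) | x <- r].
Proof.
elim: r => //= x r IH /andP[xr ur]; rewrite inE.
have [x0x _|ne /= x0r] := eqVneq x0 x; last by rewrite IH // add0n qf_osumCA.
rewrite {}x0x add1n /= -qf_osumA; apply: qf_osum_iso => //; apply: qf_osum_iso => //.
have -> // : [seq qf_nsum ((x == y) + f y)%N (B y) | y <- r] =
    [seq qf_nsum (f y) (B y) | y <- r].
by apply/eq_in_map => y yr; case: eqVneq xr => // ->; rewrite yr.
Qed.

(** The class in A(G) of the disjoint union of the G-sets G/H, for H in [s]. *)
Definition gclass_count (s : seq {group gal_of {:L}}) : burnside L :=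
  [ffun C => Posz (count (fun H => gclass H == C) s)].

Lemma dress_gclass_count s :
  (dress (gclass_count s)).1 ≃ qf_bigsum [seq form H | H <- s] /\
  (dress (gclass_count s)).2 ≃ qf_zero k.
Proof.
rewrite /dress /=; split; last first.
  elim: (enum _) => //= C r IH; rewrite IH ffunE /=; exact: qf_osum0.
have -> : [seq qf_nsum (ipos (gclass_count s C)) (dress_basis C)
            | C <- enum (subgroup_classes L)] =
    [seq qf_nsum (count (fun H => gclass H == C) s) (dress_basis C)
      | C <- enum (subgroup_classes L)].
  by apply: eq_map => C; rewrite ffunE.
elim: s => [|H s IH] /=.
  elim: (enum _) => //= C r IH; rewrite IH; exact: qf_osum0.
rewrite qf_bigsum_incr ?enum_uniq ?mem_enum ?gclass_subgroup //.
by rewrite IH dress_basis_gclass.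
Qed.

Lemma qf_nsum_bigsum_flatten (T : Type) (f : T -> qform k) n s :
  qf_nsum n (qf_bigsum [seq f x | x <- s]) ≃
  qf_bigsum [seq f x | x <- flatten (nseq n s)].
Proof. by elim: n => //= n IH; rewrite map_cat qf_bigsum_cat IH. Qed.

(** The coefficient at the class of [H] is positive on the left, where the multiplicity [m.+1] is
    nonzero, and zero on the right, since conjugate subgroups have equal order. Two distinct
    elements of A(G) then have the same image. *)
Lemma dress_not_injective m n s1 s2 H :
  qf_nsum m.+1 (qf_bigsum [seq form H | H <- s1]) ≃
  qf_nsum n (qf_bigsum [seq form H | H <- s2]) ->
  H \in s1 -> {in s2, forall H', #|H'| != #|H|} -> ~ dress_injective L.
Proof.
move=> i12 Hs1 Hs2 inj.
have eqC : burnside_eq (gclass_count (flatten (nseq m.+1 s1)))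
                       (gclass_count (flatten (nseq n s2))).
  apply: inj; have [p1 n1] := dress_gclass_count (flatten (nseq m.+1 s1)).
  have [p2 n2] := dress_gclass_count (flatten (nseq n s2)).
  exists (qf_zero k); split; first by rewrite /qf_nondeg /= trmx0 det_mx00 oner_eq0.
  rewrite p1 p2 n1 n2 !qf_osum0 -!qf_nsum_bigsum_flatten; exact: i12.
have := eqC _ (gclass_subgroup H); rewrite !ffunE => -[e].
have c1 : (0 < count (fun H' => gclass H' == gclass H) (flatten (nseq m.+1 s1)))%N.
  by rewrite -has_count; apply/hasP; exists H; rewrite //= mem_cat Hs1.
move: c1; rewrite e -has_count => /hasP[H'].
case/flattenP=> s /nseqP[-> _] /Hs2 ne /eqP/gclass_card e'.
by rewrite e' eqxx in ne.
Qed.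

End DressMap.

(** * Small subgroups and the relations they produce *)

(** An element whose order does not divide 2 has order divisible by 4 or by an odd prime, and a
    power of it has exactly that order. Otherwise every element squares to 1, so G is commutative
    and any two distinct nontrivial elements will do. *)
Lemma order4_or_odd_prime_or_Klein (gT : finGroupType) (G : {group gT}) :
  (2 < #|G|)%N ->
  [\/ exists2 z, z \in G & prime #[z]%g && odd #[z]%g,
      exists2 z, z \in G & #[z]%g = 4%N |
      exists x y, [/\ x \in G, y \in G, x != 1, y != 1 & x != y]%g /\
        [/\ x * x = 1, y * y = 1 & x * y = y * x]%g].
Proof.
move=> G2.
have [/exists_inP[x xG x2]|/exists_inPn inv] := boolP [exists x in G, x * x != 1]%g.
  have n0 := order_gt0 x; set n := #[x]%g in n0.
  have n2 : ~~ (n %| 2)%N by apply: contra x2; rewrite order_dvdn expgS expg1.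
  have [d4|nd4] := boolP (4 %| n)%N.
    apply: Or32; exists (x ^+ (n %/ 4))%g; first exact: groupX.
    by rewrite orderXdiv ?dvdn_div // -/n divnA // mulKn.
  have [m om nE] : exists2 m, odd m & n = m \/ n = (2 * m)%N.
    have nE := odd_double_half n; have hE := odd_double_half n./2.
    case on : (odd n); first by exists n => //; left.
    exists n./2; last by right; rewrite mul2n -[LHS]nE on.
    apply/negPn/negP => oh; case/negP: nd4; apply/dvdnP; exists n./2./2.
    by rewrite -{1}nE -{1}hE on (negPf oh) -!muln2 -mulnA.
  have m1 : m != 1%N by apply: contra n2; case: nE => -> /eqP ->.
  have mn : (m %| n)%N by case: nE => ->; rewrite ?dvdn_mull.
  have pm : prime (pdiv m).
    by apply: pdiv_prime; case: m om m1 {nE mn} => [|[]].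
  have pn : (pdiv m %| n)%N := dvdn_trans (pdiv_dvd m) mn.
  apply: Or31; exists (x ^+ (n %/ pdiv m))%g; first exact: groupX.
  rewrite orderXdiv ?dvdn_div // -/n divnA // mulKn // pm.
  exact: dvdn_odd (pdiv_dvd m) om.
have sq z : z \in G -> (z * z = 1)%g by move=> /inv /negPn /eqP.
have [x xG x1] : exists2 x, x \in G & x != 1%g.
  apply/trivgPn; rewrite trivg_card1; by case: #|G| G2 => [|[|[]]].
have [y /setDP[yG]] : exists y, y \in G :\: [set 1%g; x].
  apply/set0Pn; rewrite -card_gt0 cardsD subn_gt0.
  apply: leq_ltn_trans (subset_leq_card (subsetIr _ _)) _.
  by rewrite cards2; case: (_ == _) => //; apply: ltn_trans G2.
rewrite !inE negb_or => /andP[y1 yx].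
apply: Or33; exists x, y; rewrite eq_sym in yx; split; first by split.
split; [exact: sq | exact: sq |].
have V z : z \in G -> (z^-1 = z)%g.
  by move=> zG; apply: (mulgI z); rewrite mulgV sq.
by rewrite -[LHS](V _ (groupM xG yG)) invMg !V.
Qed.

(** Dividing, d = (u / (v^2 + c^2))^2 (v^2 + c^2). If the denominator vanishes then -1 = (v / c)^2,
    and every element is a sum of squares. *)
Lemma sos_quotient (F : fieldType) (u v c d : F) :
  (2%:R : F) != 0 -> c != 0 -> u ^+ 2 = d * (v ^+ 2 + c ^+ 2) -> sos d.
Proof.
move=> F2 c0 e; have [vc|vc] := eqVneq (v ^+ 2 + c ^+ 2) 0.
  have N1 : -1 = (v / c) ^+ 2.
    have c20 : c ^+ 2 != 0 by rewrite expf_neq0.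
    apply: (mulIf c20); rewrite expr_div_n divfK // mulN1r.
    by apply/eqP; rewrite eq_sym -addr_eq0 vc.
  have -> : d = ((d + 1) / 2%:R) ^+ 2 + (-1) * ((d - 1) / 2%:R) ^+ 2 by field.
  by apply: sosD; [|apply: sosM; first rewrite N1]; apply: sosX2.
have -> : d = (u / (v ^+ 2 + c ^+ 2)) ^+ 2 * (v ^+ 2 + c ^+ 2).
  by rewrite expr_div_n e; field.
by apply: sosMX; apply: sosD; apply: sosX2.
Qed.

Section NotInjective.
Variables (k : fieldType) (L : splittingFieldType k).
Hypothesis k2 : (2%:R : k) != 0.
Implicit Types (H : {group gal_of {:L}}) (x y z : gal_of {:L}).
Local Notation fix_ H := (fixedField_aspace (H : {set gal_of {:L}})).

Lemma mem_fixedField_gen (A : {set gal_of {:L}}) a :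
  reflect {in A, forall x, x a = a} (a \in fixedField <<A>>%G).
Proof.
rewrite -(galois_fixedField (fixedField_galois _)) gal_fixedField /=.
rewrite -(gal_generated A) (galois_fixedField (fixedField_galois _)).
by apply: (iffP (fixedFieldP (memvf a))).
Qed.

Lemma mem_fixedField_cycle x a : (a \in fixedField <[x]>%G) = (x a == a).
Proof.
apply/(mem_fixedField_gen [set x])/eqP => [-> //|xa y]; rewrite ?inE //.
by move/eqP->.
Qed.

Lemma mem_fixedField_pair x y a :
  (a \in fixedField <<[set x; y]>>%G) = (x a == a) && (y a == a).
Proof.
apply/(mem_fixedField_gen [set x; y])/andP => [fa|[/eqP xa /eqP ya] z].
  by rewrite !fa ?inE ?eqxx ?orbT.
by rewrite !inE => /orP[]/eqP->.
Qed.

Lemma fixedField1 : fixedField (1%G : {group gal_of {:L}}) = {:L}%VS.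
Proof.
apply/vspaceP=> a; rewrite memvf; apply/fixedFieldP; rewrite ?memvf // => x.
by rewrite inE => /eqP->; rewrite gal_id.
Qed.

(** By the Galois correspondence, an automorphism that fixes L^H pointwise lies in H. *)
Lemma fixedField_moved H y : y \notin H -> exists2 u, u \in fixedField H & y u != u.
Proof.
move=> yH; apply: NNPP => nu; case/negP: yH.
rewrite -(gal_fixedField H) gal_kHom ?fixedField_bound //; apply/kAHomP => u uH.
by apply/eqP/negPn/negP => yu; apply: nu; exists u.
Qed.

(* If <[z]> is cyclic of order 4 and E / K is the quadratic subextension, with
   [z t = - t], take [b] with [z ^+ 2 b = - b] and put [c := b * z b / t].
   The norm from E to K of [b ^+ 2 = u + v * t] is
   [u ^+ 2 - t ^+ 2 * v ^+ 2 = t ^+ 2 * c ^+ 2]. *)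
Lemma cyclic4_sos z (d : subvs_of (fix_ <[z]>%G)) t :
  #[z]%g = 4%N -> z t = - t -> t != 0 -> vsval d = t ^+ 2 -> sos d.
Proof.
move=> z4 zt t0 dt; have L2 := char_ext k2 L.
set K := fix_ _ in d dt *.
have zzE a : (z * z)%g a = z (z a) by rewrite galM ?memvf.
have zz1 : (z * z)%g \notin (1%G : {group gal_of {:L}}).
  by rewrite inE -[(z * z)%g]/(z ^+ 2)%g -order_dvdn z4.
have [w _] := fixedField_moved zz1; rewrite zzE => zzw.
pose b := w - z (z w).
have z4w a : z (z (z (z a))) = a.
  have : (z ^+ 4)%g = 1%g by rewrite -z4 expg_order.
  move/(congr1 (fun x : gal_of {:L} => x a)); rewrite gal_id => {2}<-.
  by rewrite -[(z ^+ 4)%g]/(z * (z * (z * z)))%g !galM ?memvf.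
have zzb : z (z b) = - b by rewrite /b !rmorphB /= z4w opprB.
have b0 : b != 0 by rewrite subr_eq0 eq_sym.
have zb0 : z b != 0 by rewrite fmorph_eq0.
have inK a : z a = a -> a \in K by move=> za; rewrite mem_fixedField_cycle za.
have uK : (b ^+ 2 + z b ^+ 2) / 2%:R \in K.
  apply: inK; rewrite fmorph_div rmorphD !rmorphXn rmorph_nat /= zzb sqrrN.
  by rewrite addrC.
have vK : (b ^+ 2 - z b ^+ 2) / (2%:R * t) \in K.
  apply: inK; rewrite fmorph_div rmorphB !rmorphXn rmorphM rmorph_nat /= zzb sqrrN zt.
  by field; rewrite t0 L2 oppr_eq0 t0.
have cK : b * z b / t \in K.
  apply: inK; rewrite fmorph_div rmorphM /= zzb zt; field.
  by rewrite t0 oppr_eq0 t0.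
pose u := vsproj K ((b ^+ 2 + z b ^+ 2) / 2%:R).
pose v := vsproj K ((b ^+ 2 - z b ^+ 2) / (2%:R * t)).
pose c := vsproj K (b * z b / t).
have e : u ^+ 2 = d * (v ^+ 2 + c ^+ 2).
  apply: val_inj; rewrite /= ?rmorphM ?rmorphD ?rmorphXn /= dt !vsprojK //.
  by field; rewrite t0 L2.
have c0 : c != 0.
  apply/eqP => c0; have := vsprojK cK; rewrite -/c c0 rmorph0 => /esym/eqP.
  by rewrite !mulf_eq0 invr_eq0 (negPf b0) (negPf zb0) (negPf t0).
exact: sos_quotient (char_ext k2 _) c0 e.
Qed.

Lemma dress_not_injective_odd z : prime #[z]%g -> odd #[z]%g -> ~ dress_injective L.
Proof.
move=> pz oz; have [N iN] := nsum_trace_form_odd k2 (H := <[z]>%G) oz.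
apply: (@dress_not_injective _ _ N (N.+1 * #|<[z]>%g|) [:: 1%G] [:: <[z]>%G] 1%G).
- by rewrite /= !qf_osum0 fixedField1.
- exact: mem_head.
by move=> H'; rewrite inE => /eqP->; rewrite cards1 neq_ltn prime_gt1 ?orbT.
Qed.

(** Used twice: for [H1] of order 2 in a cyclic group [H2] of order 4, and for [H1] trivial in a
    Galois group [H2] of order 2. *)
Lemma dress_not_injective_quadratic (H1 H2 : {group gal_of {:L}}) z t
    (d : subvs_of (fix_ H2)) :
  H1 \subset H2 -> #|H1| != #|H2| -> z \in H2 ->
  {in fix_ H1, forall a, a + z a \in fix_ H2} ->
  t \in fix_ H1 -> t != 0 -> z t = - t -> vsval d = t ^+ 2 -> sos d ->
  ~ dress_injective L.
Proof.
move=> s12 n12 zH2 H1z tH1 t0 zt dt sd.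
have [|N iN] := nsum_trace_form_quadratic k2 (fixedFieldS s12) _ H1z tH1 t0 zt dt sd.
  by move=> a /(fixedFieldP (memvf a)); apply.
apply: (@dress_not_injective _ _ N (N.+1 * 2) [:: H1] [:: H2] H1).
- by rewrite /= !qf_osum0.
- exact: mem_head.
by move=> H'; rewrite inE eq_sym in n12 * => /eqP->.
Qed.

Lemma dress_not_injective_cyclic4 z : #[z]%g = 4%N -> ~ dress_injective L.
Proof.
move=> z4.
have z2 : #[(z * z)%g]%g = 2%N by rewrite -[(z * z)%g]/(z ^+ 2)%g orderXdiv z4.
have s12 : <[z * z]>%G \subset <[z]>%G by rewrite cycle_subG groupM ?cycle_id.
have n12 : #|<[z * z]>%G| != #|<[z]>%G| by rewrite -!orderE z2 z4.
have nz : z \notin <[z * z]>%G.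
  by apply: contra n12; rewrite -cycle_subG => s21; apply/eqP/eq_card/subset_eqP/andP.
have zz a : a \in fix_ <[z * z]>%G -> z (z a) = a.
  by rewrite mem_fixedField_cycle galM ?memvf // => /eqP.
have [u uE zu] := fixedField_moved nz.
have inK a : z a = a -> a \in fix_ <[z]>%G by move=> za; rewrite mem_fixedField_cycle za.
(* As z^2 fixes u, this element is negated by z; it generates the fixed field of z^2 over that of
   z. *)
pose t := u - z u.
have zt : z t = - t by rewrite /t rmorphB /= zz // opprB.
have t0 : t != 0 by rewrite subr_eq0 eq_sym.
have tK : t ^+ 2 \in fix_ <[z]>%G by apply: inK; rewrite rmorphXn /= zt sqrrN.
have dt : vsval (vsproj (fix_ <[z]>%G) (t ^+ 2)) = t ^+ 2 by rewrite vsprojK.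
apply: (dress_not_injective_quadratic s12 n12 (cycle_id z) _ _ t0 zt dt).
- by move=> a aE; apply: inK; rewrite rmorphD /= zz // addrC.
- by rewrite mem_fixedField_cycle galM ?memvf // !zt rmorphN /= zt opprK.
exact: cyclic4_sos z4 zt t0 dt.
Qed.

Lemma dress_not_injective_klein x y :
  x != 1%g -> y != 1%g -> x != y -> (x * x = 1)%g -> (y * y = 1)%g -> (x * y = y * x)%g ->
  ~ dress_injective L.
Proof.
move=> x1 y1 xy xx yy cxy.
have xxE a : x (x a) = a by rewrite -galM ?memvf // xx gal_id.
have yyE a : y (y a) = a by rewrite -galM ?memvf // yy gal_id.
have xyE a : x (y a) = y (x a) by rewrite -!galM ?memvf // cxy.
have ord2 z : z != 1%g -> (z * z = 1)%g -> #[z]%g = 2%N.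
  by move=> z1 zz; apply: nt_prime_order => //; rewrite expgS expg1.
pose V := <<[set x; y]>>%G.
have inV a : x a = a -> y a = a -> a \in fix_ V.
  by move=> xa ya; rewrite mem_fixedField_pair xa ya !eqxx.
have inC z a : z a = a -> a \in fix_ <[z]>%G.
  by move=> za; rewrite mem_fixedField_cycle za.
have Cz z a : a \in fix_ <[z]>%G -> z a = a.
  by rewrite mem_fixedField_cycle => /eqP.
have notin z w : z != 1%g -> (z * z = 1)%g -> w != 1%g -> z != w -> w \notin <[z]>%G.
  by move=> z1 zz w1 zw; rewrite /= (cycle2g (ord2 _ z1 zz)) !inE negb_or w1 eq_sym.
have [u /Cz xu yu] := fixedField_moved (notin _ _ x1 xx y1 xy).
have [v /Cz yv xv] : exists2 v, v \in fixedField <[y]>%G & x v != v.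
  by apply/fixedField_moved/notin; rewrite // eq_sym.
(* Eigenvectors of the Klein group: x fixes s and y negates it, while x negates t and y fixes it.
   Hence x * y fixes s * t, and s^2 and t^2 lie in the base field. *)
pose s := u - y u; pose t := v - x v.
have xs : x s = s by rewrite /s rmorphB /= xyE xu.
have ys : y s = - s by rewrite /s rmorphB /= yyE opprB.
have yt : y t = t by rewrite /t rmorphB /= -xyE yv.
have xt : x t = - t by rewrite /t rmorphB /= xxE opprB.
have s0 : s != 0 by rewrite subr_eq0 eq_sym.
have t0 : t != 0 by rewrite subr_eq0 eq_sym.
have s2K : s ^+ 2 \in fix_ V by apply: inV; rewrite rmorphXn /= ?xs ?ys ?sqrrN.
have t2K : t ^+ 2 \in fix_ V by apply: inV; rewrite rmorphXn /= ?xt ?yt ?sqrrN.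
have subV z : z \in V -> (fix_ V <= fix_ <[z]>%G)%VS.
  by move=> zV; apply: fixedFieldS; rewrite cycle_subG.
have xV : x \in V by rewrite mem_gen // !inE eqxx.
have yV : y \in V by rewrite mem_gen // !inE eqxx orbT.
have [|||||||||||||||N iN] := @nsum_trace_form_biquadratic _ _ k2 (fix_ V) (fix_ <[x]>%G)
    (fix_ <[y]>%G) (fix_ <[x * y]>%G) (fix_ 1%G) x y s t
    (vsproj (fix_ V) (s ^+ 2)) (vsproj (fix_ V) (t ^+ 2)).
- exact: subV.
- exact: subV.
- by apply: subV; apply: groupM.
- by apply: fixedFieldS; rewrite sub1G.
- exact: Cz.
- exact: Cz.
- by move=> a _; apply: inC; rewrite rmorphD /= xxE addrC.
- by move=> a /Cz xa; apply: inV; rewrite rmorphD /= ?xyE ?yyE ?xa // addrC.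
- by move=> a /Cz ya; apply: inV; rewrite rmorphD /= ?xxE -?xyE ?ya // addrC.
- move=> a /Cz; rewrite galM ?memvf // => xya.
  have ya : y a = x a by rewrite -{1}xya yyE.
  by apply: inV; rewrite rmorphD /= ?xxE ?xya ?ya addrC.
- by split=> //; apply: inC.
- by split=> //; [apply: inC |
    exact: (eq_ind_r (fun U : {vspace L} => t \in U) (memvf t) fixedField1)].
- by apply: inC; rewrite galM ?memvf // !rmorphM /= xs xt rmorphN /= ys yt mulrNN.
- by rewrite vsprojK.
- by rewrite vsprojK.
apply: (@dress_not_injective _ _ N N.+1 [:: 1%G; V; V] [:: <[x]>%G; <[y]>%G; <[x * y]>%G] 1%G).
- apply: qf_iso_trans iN (qf_nsum_iso _ _).
  by rewrite /= qf_osum0 qf_osumA.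
- exact: mem_head.
have xy1 : (x * y)%g != 1%g by apply: contra xy => /eqP e; rewrite -(mulg1 x) -yy mulgA e mul1g.
have xyxy : (x * y * (x * y) = 1)%g by rewrite {2}cxy mulgA -(mulgA x) yy mulg1 xx.
by move=> H'; rewrite !inE => /or3P[]/eqP->; rewrite cards1 -orderE ord2.
Qed.

Lemma dress_not_injective_big : (2 < #|GalG L|)%N -> ~ dress_injective L.
Proof.
case/order4_or_odd_prime_or_Klein => [[z _ /andP[pz oz]]|[z _ z4]|].
- exact: dress_not_injective_odd pz oz.
- exact: dress_not_injective_cyclic4 z4.
by case=> x [y [[_ _ x1 y1 xy] [xx yy cxy]]]; apply: dress_not_injective_klein xy xx yy cxy.
Qed.

End NotInjective.

(** * Witt cancellation *)

Section WittCancellation.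
Variable k : fieldType.
Hypothesis k2 : (2%:R : k) != 0.
Implicit Types q t : qform k.
Local Notation "q1 ≃ q2" := (@qf_iso k q1 q2) (at level 70).
Local Notation "q1 ⊥ q2" := (@qf_osum k q1 q2) (at level 50, left associativity).

(** Isometry weakened by asking no inverse of P. This relation is still closed under composition and
    sums, and it suffices here, since in the end cancellation only has to exhibit one value of
    j<2>. *)
Definition qf_rep q1 q2 := exists P : 'M_(qdim q1, qdim q2), P^T *m qmx q1 *m P = qmx q2.

Definition qf_cancel t := forall q1 q2, qf_rep (q1 ⊥ t) (q2 ⊥ t) -> qf_rep q1 q2.

Lemma qf_iso_rep q1 q2 : q1 ≃ q2 -> qf_rep q1 q2.
Proof. by case=> P [Q [_ _ e]]; exists P. Qed.

Lemma qf_rep_trans q1 q2 q3 : qf_rep q1 q2 -> qf_rep q2 q3 -> qf_rep q1 q3.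
Proof. by case=> P e [Q f]; exists (P *m Q); rewrite trmx_mul -f -e !mulmxA. Qed.

Lemma qf_rep_iso q1 q1' q2 q2' : q1 ≃ q1' -> q2 ≃ q2' -> qf_rep q1 q2 -> qf_rep q1' q2'.
Proof.
move=> /qf_iso_sym/qf_iso_rep r1 /qf_iso_rep r2 r.
exact: qf_rep_trans r1 (qf_rep_trans r r2).
Qed.

Lemma qf_rep_osum q1 q2 q3 q4 : qf_rep q1 q2 -> qf_rep q3 q4 -> qf_rep (q1 ⊥ q3) (q2 ⊥ q4).
Proof.
move=> [P e] [Q f]; exists (block_mx P 0 0 Q).
rewrite /= tr_block_mx !trmx0 !mulmx_block.
by rewrite !(mulmx0, mul0mx, addr0, add0r) e f.
Qed.

Lemma qf_rep_nsum n q1 q2 : qf_rep q1 q2 -> qf_rep (qf_nsum n q1) (qf_nsum n q2).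
Proof.
move=> r; elim: n => [|n IH]; first exact/qf_iso_rep/qf_iso_refl.
exact: qf_rep_osum.
Qed.

(* The reflection argument behind Witt's theorem, written out in coordinates:
   the isometry [[A, b], [c, d]] is corrected to [A + (e - d)^-1 * b * c],
   where the sign [e] is chosen different from [d]. *)
Lemma qf_cancel_qf1 a : qf_cancel (qf1 a).
Proof.
move=> [m M] [n N] /= [P]; rewrite /qf_osum /= => eP.
pose A := ulsubmx (P : 'M_(m + 1, n + 1)); pose b := ursubmx (P : 'M_(m + 1, n + 1)).
pose c := dlsubmx (P : 'M_(m + 1, n + 1)); pose D := drsubmx (P : 'M_(m + 1, n + 1)).
pose d := D 0 0; have Dd : D = d%:M by apply: mx11_scalar.
move: eP; rewrite -(submxK (P : 'M_(m + 1, n + 1))) -/A -/b -/c -/D tr_block_mx.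
rewrite !mulmx_block !mulmx0 !addr0 !add0r Dd tr_scalar_mx -!scalar_mxM.
rewrite !mul_mx_scalar !mul_scalar_mx => /eq_block_mx[e1 e2 e3 e4].
have [e ed e21] : exists2 e : k, e - d != 0 & e ^+ 2 = 1.
  have [d1|d1] := eqVneq d 1; last by exists 1; rewrite ?expr1n // subr_eq0 eq_sym.
  by exists (-1); rewrite ?sqrrN ?expr1n // d1 -opprD oppr_eq0.
pose l := (e - d)^-1; exists (A + l *: (b *m c)).
have e4' : b^T *m M *m b = (a - a * d * d)%:M.
  by move/(canRL (addrK _)): e4 => ->; rewrite -raddfB /= [d * a]mulrC.
have e1' : A^T *m M *m A = N - a *: (c^T *m c).
  by move: e1; rewrite -scalemxAl => /(canRL (addrK _)).
have e2' : A^T *m M *m b = - (d * a) *: c^T.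
  by move: e2; rewrite scalerA => /(canRL (addrK _)); rewrite sub0r scaleNr.
have e3' : b^T *m M *m A = - (d * a) *: c.
  by move/(canRL (addrK _)): e3; rewrite sub0r scaleNr.
have -> : (A + l *: (b *m c))^T = A^T + l *: (c^T *m b^T).
  by rewrite linearD /= linearZ /= trmx_mul.
rewrite /= !mulmxDl !mulmxDr -!scalemxAl -!scalemxAr.
rewrite !mulmxA e1' e2' -!(mulmxA c^T) e3' e4'.
rewrite mul_scalar_mx -?scalemxAl -?scalemxAr !scalerA.
rewrite -!addrA -{2}[N]addr0; congr (N + _).
rewrite -!scaleNr -!scalerDl.
suff -> : - a + (l * - (d * a) + (l * - (d * a) + l * (l * (a - a * d * d)))) = 0.
  by rewrite scale0r.
have -> : a - a * d * d = a * (e ^+ 2 - d ^+ 2) by rewrite e21; ring.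
by rewrite /l; field.
Qed.

Lemma qf_cancel_iso t t' : t ≃ t' -> qf_cancel t -> qf_cancel t'.
Proof.
move=> tt ct q1 q2 r; apply: ct; apply: qf_rep_iso r; by rewrite tt.
Qed.

Lemma qf_cancel_osum t t' : qf_cancel t -> qf_cancel t' -> qf_cancel (t ⊥ t').
Proof.
move=> ct ct' q1 q2 r; apply: ct; apply: ct'.
by apply: qf_rep_iso r; rewrite qf_osumA.
Qed.

Lemma qf_cancel_nsum n t : qf_cancel t -> qf_cancel (qf_nsum n t).
Proof.
move=> ct; elim: n => [|n IH] /=; last exact: qf_cancel_osum.
by move=> q1 q2; apply: qf_rep_iso; apply: qf_osum0.
Qed.

(* With [X := (A + B) / 2] and [Y := (A - B) / 2], the matrix [[X, Y], [Y, X]]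
   has the required effect. *)
Lemma qf_rep_opp_double n (A B U W : 'M[k]_n) :
  A^T = A -> B^T = B -> A *m U *m B = W -> B *m U *m A = W ->
  qf_rep (@QForm k n U ⊥ @QForm k n (- U)) (@QForm k n W ⊥ @QForm k n (- W)).
Proof.
move=> AT BT AUB BUA; pose h : k := 2%:R^-1.
pose X s := h *: (A + s *: B).
have XT s : (X s)^T = X s by rewrite /X linearZ /= linearD /= linearZ /= AT BT.
have E s s' : X s *m U *m X s' =
    (h * h) *: (A *m U *m A + (s + s') *: W + (s * s') *: (B *m U *m B)).
  rewrite /X -!scalemxAl -scalemxAr scalerA !mulmxDl !mulmxDr -!scalemxAl -!scalemxAr.
  rewrite AUB BUA scalerA scalerDl; congr (_ *: _).
  by rewrite -!addrA; congr (_ + _); rewrite addrCA.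
exists (block_mx (X 1) (X (-1)) (X (-1)) (X 1)).
rewrite /= tr_block_mx !XT !mulmx_block !(mulmx0, mul0mx, addr0, add0r) !mulmxN !mulNmx !E.
move: (A *m U *m A) (B *m U *m B) => p q.
by congr block_mx; apply/matrixP=> i j; rewrite !mxE /h; field.
Qed.

(* [t] plus its opposite is equivalent to a sum of unit forms and their
   opposites, so it suffices to cancel one-dimensional forms. *)
Lemma qf_cancel_nondeg t : qf_nondeg t -> qf_cancel t.
Proof.
case: t => n T [/= Ts dT] q1 q2 r.
have uT : T \in unitmx by rewrite unitmxE unitfE.
have Vs : (invmx T)^T = invmx T by rewrite trmx_inv Ts.
pose hyp := @QForm k n T ⊥ @QForm k n (- T).
pose unit := @QForm k n 1%:M ⊥ @QForm k n (- 1%:M).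
have r1 : qf_rep unit hyp.
  by apply: (@qf_rep_opp_double n T 1%:M); rewrite ?trmx1 ?mulmx1 ?mul1mx.
have r2 : qf_rep hyp unit.
  by apply: (@qf_rep_opp_double n (invmx T) 1%:M);
    rewrite ?trmx1 ?mulmx1 ?mul1mx ?mulmxV ?mulVmx.
have c : qf_cancel unit.
  rewrite /unit -raddfN; apply: qf_cancel_osum;
    apply: qf_cancel_iso (qf_nsum_qf1 _ _) _; exact/qf_cancel_nsum/qf_cancel_qf1.
apply: c; apply: qf_rep_trans (qf_rep_osum (qf_iso_rep (qf_iso_refl _)) r1) _.
apply: qf_rep_trans (qf_rep_osum (qf_iso_rep (qf_iso_refl _)) r2).
apply: qf_rep_iso (qf_iso_sym (qf_osumA _ _ _)) (qf_iso_sym (qf_osumA _ _ _)) _.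
exact: qf_rep_osum r (qf_iso_rep (qf_iso_refl _)).
Qed.

Lemma qf_iso_dim q1 q2 : q1 ≃ q2 -> qdim q1 = qdim q2.
Proof.
case=> P [Q [PQ QP _]]; apply/eqP; rewrite eqn_leq.
have : (\rank (P *m Q) <= qdim q2)%N by apply: leq_trans (mxrankM_maxl _ _) (rank_leq_col _).
have : (\rank (Q *m P) <= qdim q1)%N by apply: leq_trans (mxrankM_maxl _ _) (rank_leq_col _).
by rewrite PQ QP !mxrank1 => -> ->.
Qed.

Lemma qdim_nsum n q : qdim (qf_nsum n q) = (n * qdim q)%N.
Proof. by elim: n => //= n ->. Qed.

(** With j = b1 - b2, equality of dimensions gives a2 = a1 + 2j. Cancelling a1<1> + b2 qL leaves
    2j<1> against j<2, 2a>; since 2<1> is isometric to <2, 2>, j<2> cancels as well, and 2a is a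
    value of j<2>. *)
Lemma sos_of_rep (a : k) a1 b1 a2 b2 :
  (b2 < b1)%N -> (a1 + b1 * 2 = a2 + b2 * 2)%N ->
  let qL := qf1 2%:R ⊥ qf1 (2%:R * a) in
  qf_rep (qf_nsum a2 (qf1 1) ⊥ qf_nsum b2 qL) (qf_nsum a1 (qf1 1) ⊥ qf_nsum b1 qL) ->
  sos a.
Proof.
move=> b21 e qL r.
have [j [j0 b1E a2E]] : exists j, [/\ (0 < j)%N, b1 = (j + b2)%N & a2 = (j * 2 + a1)%N].
  by exists (b1 - b2)%N; split; lia.
have two : qf_rep (qf1 2%:R ⊥ qf1 2%:R) (qf_nsum 2 (qf1 (1 : k))).
  have r1 : qf_rep (qf1 2%:R ⊥ qf1 2%:R) (qf1 1 ⊥ qf1 1).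
    (* The matrix [[1, 1], [1, -1]] / 2 carries <2, 2> to <1, 1>. *)
    pose h : k := 2%:R^-1; exists (block_mx h%:M h%:M h%:M (- h)%:M).
    rewrite /= tr_block_mx !tr_scalar_mx !mulmx_block !(mulmx0, mul0mx, addr0, add0r).
    rewrite -!scalar_mxM -!raddfD /= -[0 in RHS](raddf0 (@scalar_mx k 1)).
    by congr block_mx; congr (_%:M); rewrite /h; field.
  by apply: qf_rep_iso r1; rewrite /= ?qf_osum0.
pose t := qf_nsum a1 (qf1 (1 : k)) ⊥ qf_nsum b2 qL.
have ct : qf_cancel t.
  by apply: qf_cancel_osum; apply: qf_cancel_nsum; try apply: qf_cancel_osum;
    apply: qf_cancel_qf1.
have r2 : qf_rep (qf_nsum j (qf1 2%:R)) (qf_nsum j (qf1 (2%:R * a))).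
  have cj : qf_cancel (qf_nsum j (qf1 2%:R)) by exact/qf_cancel_nsum/qf_cancel_qf1.
  apply: cj.
  apply: ct; apply: (qf_rep_trans (q2 := qf_nsum (j * 2) (qf1 1) ⊥ t)).
    apply: qf_rep_osum; last exact/qf_iso_rep/qf_iso_refl.
    apply: qf_rep_iso (qf_nsum_osum _ _ _) (qf_iso_sym (qf_nsumM _ _ _)) _.
    exact: qf_rep_nsum.
  apply: qf_rep_iso r.
    by rewrite a2E qf_nsumD -qf_osumA.
  by rewrite b1E qf_nsumD qf_nsum_osum qf_osumCA (qf_osumC (qf_nsum j (qf1 2%:R))).
have [P] := qf_rep_iso (qf_nsum_qf1 _ _) (qf_nsum_qf1 _ _) r2.
case: j j0 P {b1E a2E r2} => // j _ P /= /(congr1 (fun A : 'M_j.+1 => A 0 0)).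
(* The corner entry says that twice the sum of the squares of the P_i0 equals 2a. *)
rewrite mul_mx_scalar -scalemxAl !mxE eqxx mulr1n => /(mulfI k2) <-.
exists [seq P i 0 | i <- enum 'I_j.+1]; rewrite big_map big_enum /=.
by apply: eq_bigr => i _; rewrite mxE expr2.
Qed.

End WittCancellation.

(** * Quadratic extensions *)

Section QuadraticDress.
Variables (k : fieldType) (L : splittingFieldType k).
Hypothesis k2 : (2%:R : k) != 0.
Hypothesis galL : galois 1%AS {:L}%AS.
Local Notation "q1 ≃ q2" := (qf_iso q1 q2) (at level 70).
Local Notation "q1 ⊥ q2" := (qf_osum q1 q2) (at level 50, left associativity).
Local Notation form H := (trace_form (fixedField (H : {set gal_of {:L}}))).

Lemma tf_base (c : k) : tf 1%VS (c%:A : L) ≃ qf1 c.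
Proof.
(* The vector in [vbasis 1%VS] is an unspecified multiple of 1, so traces and coordinates are
   computed in the basis 1 instead. *)
pose co (y : L) := coord [tuple (1 : L)] 0 y.
have coA a : co a%:A = a.
  by rewrite /co linearZ /= (coord_free 0 0) ?eqxx ?mulr1 // seq1_free oner_eq0.
have coE (y : subvs_of (1%VS : {vspace L})) : vsval y = (co (vsval y))%:A.
  by have /vlineP[a ->] := valP y; rewrite coA.
have tr a : ftrace 1%VS (a%:A : L) = a.
  rewrite /ftrace (trace_indep (U := 1%VS) (J := unit)
    (v := fun i : 'I_(\dim (1%VS : {vspace L})) => (vbasis 1%VS)`_i)
    (c := fun i y => coord (vbasis 1%VS) i y)
    (v' := fun=> 1) (c' := fun=> co) (u := fun y => a%:A * y)).
  - by rewrite (big_pred1 tt) => [|[]//]; rewrite mulr1 coA.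
  - by move=> i b y z; rewrite linearP.
  - by move=> i; apply: vbasis_mem; rewrite mem_nth ?size_tuple.
  - by move=> y yE; rewrite {1}(coord_vbasis yE).
  - by move=> i b y z; rewrite /co linearP.
  - by move=> _; apply: mem1v.
  - by move=> y /vlineP[b ->]; rewrite (big_pred1 tt) => [|[]//]; rewrite coA.
  - by move=> b y z; rewrite mulrDr scalerAr.
  by move=> y y1; rewrite mulr_algl rpredZ.
apply: models_iso (tf_models _ _) _.
apply: (@models_isom _ _ _ _ _ (fun y : subvs_of 1%VS => (co (vsval y))%:M : 'rV_1)
  (fun r : 'rV_1 => vsproj 1%VS (r 0 0)%:A)) (qev_models (qf1 c)).
- by move=> a y z; rewrite /co !linearP raddfD /= -scale_scalar_mx.
- by move=> y; apply: val_inj; rewrite /= mxE eqxx mulr1n -coE vsvalK.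
- move=> r; rewrite vsprojK ?rpredZ ?mem1v // coA; apply/rowP=> i.
  by rewrite (ord1 i) mxE eqxx mulr1n.
move=> y z; rewrite [in LHS](coE y) [in LHS](coE z) mulr_algl scalerA mulr_algl scalerA tr.
by rewrite /qev /= tr_scalar_mx !mul_mx_scalar !mxE eqxx !mulr1n; ring.
Qed.

Lemma tf_quadratic_base (K E : {subfield L}) (g : gal_of {:L}) (t : L) (a : k) :
  K = 1%VS :> {vspace L} ->
  (K <= E)%VS -> {in K, forall x, g x = x} -> {in E, forall x, x + g x \in K} ->
  t \in E -> t != 0 -> g t = - t -> t ^+ 2 = a%:A ->
  trace_form E ≃ qf1 2%:R ⊥ qf1 (2%:R * a).
Proof.
move=> K1 sKE gK gE tE t0 gt ta.
have [d dt] : exists d : subvs_of K, vsval d = t ^+ 2.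
  by exists a%:A; rewrite ta linearZ rmorph1.
have v2 : vsval (2%:R * 1 : subvs_of K) = 2%:R%:A.
  by rewrite mulr1 rmorph_nat scaler_nat.
have v2d : vsval (2%:R * 1 * d) = (2%:R * a)%:A.
  transitivity (vsval (2%:R * 1 : subvs_of K) * vsval d); first exact: rmorphM.
  by rewrite v2 dt ta mulr_algl scalerA.
have := tf_quadratic k2 1 sKE gK gE tE t0 gt dt.
rewrite -(trace_form_tf1 K) v2 v2d K1 => q; apply: qf_iso_trans q _.
by apply: qf_osum_iso; apply: tf_base.
Qed.

Lemma fixedField_GalG : fixedField (GalG L) = 1%VS.
Proof. exact: galois_fixedField galL. Qed.

Section OrderTwo.
Variables (z : gal_of {:L}) (alpha : k) (s : L).
Hypotheses (Gz : GalG L = <[z]>%g) (zs : z s = - s) (s0 : s != 0).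
Hypothesis s2 : s ^+ 2 = alpha%:A.
Hypothesis zz : forall a, z (z a) = a.

Let fix_z : fixedField <[z]>%G = 1%VS :> {vspace L}.
Proof. by rewrite -fixedField_GalG Gz. Qed.

Lemma trace_form_quadratic_base : form 1%G ≃ qf1 2%:R ⊥ qf1 (2%:R * alpha).
Proof.
set K := fixedField_aspace <[z]>%G.
have inK a : z a = a -> a \in K by move=> za; rewrite mem_fixedField_cycle za.
have e1 : fixedField_aspace (1%G : {group gal_of {:L}}) = {:L}%VS :> {vspace L}.
  exact: fixedField1.
have sub : (K <= fixedField_aspace (1%G : {group gal_of {:L}}))%VS.
  by apply: fixedFieldS; rewrite sub1G.
have Kz : {in K, forall a, z a = a}.
  by move=> a; rewrite mem_fixedField_cycle => /eqP.
have trK : {in fixedField_aspace (1%G : {group gal_of {:L}}), forall a, a + z a \in K}.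
  by move=> a _; apply: inK; rewrite rmorphD /= zz addrC.
have s1 : s \in fixedField_aspace (1%G : {group gal_of {:L}}) by rewrite e1 memvf.
have := tf_quadratic_base (K := K) fix_z sub Kz trK s1 s0 zs s2.
by rewrite /= fixedField1.
Qed.

Lemma trace_form_base : form <[z]>%G ≃ qf1 1.
Proof. by rewrite fix_z trace_form_tf; have := tf_base 1; rewrite scale1r. Qed.

Lemma subgroup_order2 (H : {group gal_of {:L}}) : #[z]%g = 2%N ->
  H = 1%G \/ H = <[z]>%G.
Proof.
move=> z2; have zE x : x \in <[z]>%g by rewrite -Gz mem_GalG.
have [zH|zH] := boolP (z \in H); [right|left]; apply/val_inj/setP=> x /=.
  by rewrite zE; apply: (subsetP (_ : <[z]> \subset H)%g); rewrite ?cycle_subG ?zE.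
rewrite inE; have := zE x; rewrite cycle2g // !inE => /orP[]/eqP->.
  by rewrite group1 eqxx.
by rewrite (negPf zH) -order_eq1 z2.
Qed.

Lemma qf_bigsum_rem (T : eqType) (f : T -> qform k) (x : T) r : x \in r ->
  qf_bigsum [seq f y | y <- r] ≃ f x ⊥ qf_bigsum [seq f y | y <- rem x r].
Proof.
elim: r => //= y r IH; rewrite inE eq_sym; case: eqVneq => [-> //|_ /= xr].
by rewrite (IH xr) qf_osumCA.
Qed.

Lemma qf_bigsum_classes (f : {set {group gal_of {:L}}} -> qform k) : #[z]%g = 2%N ->
  qf_bigsum [seq f C | C <- enum (subgroup_classes L)] ≃
  f (gclass 1%G) ⊥ f (gclass <[z]>%G).
Proof.
move=> z2; have ne : gclass <[z]>%G != gclass 1%G.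
  by apply/eqP => /gclass_card; rewrite -orderE z2 cards1.
have cE C : (C \in subgroup_classes L) = (C == gclass 1%G) || (C == gclass <[z]>%G).
  apply/imsetP/orP => [[H _ ->]|[]/eqP->].
  - by have [->|->] := subgroup_order2 H z2; [left | right]; apply/eqP.
  - by apply/imsetP; exact: gclass_subgroup.
  - by apply/imsetP; exact: gclass_subgroup.
have u := enum_uniq (subgroup_classes L).
rewrite (qf_bigsum_rem _ (x := gclass 1%G)) ?mem_enum ?cE ?eqxx //.
have m2 : gclass <[z]>%G \in rem (gclass 1%G) (enum (subgroup_classes L)).
  by rewrite mem_rem_uniq // !inE ne mem_enum cE eqxx orbT.
rewrite (qf_bigsum_rem _ m2).
have -> : rem (gclass <[z]>%G) (rem (gclass 1%G) (enum (subgroup_classes L))) = [::].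
  apply/eqP; rewrite -size_eq0 -leqn0 leqNgt -has_predT; apply/negP => /hasP[C].
  rewrite mem_rem_uniq ?rem_uniq // inE mem_rem_uniq // inE mem_enum cE.
  by case/and3P=> /negPf-> /negPf->.
by rewrite /= qf_osum0.
Qed.

(** With negative parts moved across, a relation reads a1<1> + b1 qL = a2<1> + b2 qL up to a
    stabilising form. If b1 and b2 differ, the isometry, read in the suitable direction, makes alpha
    a sum of squares; if they agree, dimensions give a1 = a2. *)
Lemma dress_injective_quadratic : #[z]%g = 2%N -> ~ sos alpha -> dress_injective L.
Proof.
move=> z2 nsa x y [t [ndt]].
set C1 := gclass (1%G : {group gal_of {:L}}); set Cz := gclass <[z]>%G.
pose qL := qf1 2%:R ⊥ qf1 (2%:R * alpha).
pose X (a b : nat) := qf_nsum a (qf1 1) ⊥ qf_nsum b qL.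
have i1 : dress_basis C1 ≃ qL.
  by rewrite dress_basis_gclass; apply: trace_form_quadratic_base.
have iz : dress_basis Cz ≃ qf1 1.
  by rewrite dress_basis_gclass; apply: trace_form_base.
have dE (f : {set {group gal_of {:L}}} -> nat) :
    qf_bigsum [seq qf_nsum (f C) (dress_basis C) | C <- enum (subgroup_classes L)]
    ≃ X (f Cz) (f C1).
  by rewrite (qf_bigsum_classes (fun C => qf_nsum (f C) (dress_basis C)) z2) i1 iz qf_osumC.
have XD a b a' b' : X a b ⊥ X a' b' ≃ X (a + a') (b + b').
  by rewrite /X qf_osumACA !qf_nsumD.
(* The numbers a count G/G, with trace form <1>, and the numbers b count G/1, with trace form qL. *)
set a1 := (ipos (x Cz) + ineg (y Cz))%N; set b1 := (ipos (x C1) + ineg (y C1))%N.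
set a2 := (ipos (y Cz) + ineg (x Cz))%N; set b2 := (ipos (y C1) + ineg (x C1))%N.
have dx : (dress x).1 ⊥ (dress y).2 ≃ X a1 b1.
  by apply: qf_iso_trans (XD _ _ _ _); apply: qf_osum_iso;
    [apply: (dE (fun C => ipos (x C))) | apply: (dE (fun C => ineg (y C)))].
have dy : (dress y).1 ⊥ (dress x).2 ≃ X a2 b2.
  by apply: qf_iso_trans (XD _ _ _ _); apply: qf_osum_iso;
    [apply: (dE (fun C => ipos (y C))) | apply: (dE (fun C => ineg (x C)))].
rewrite dx dy => iXt.
have dimE : (a1 + b1 * 2 = a2 + b2 * 2)%N.
  have := qf_iso_dim iXt; rewrite /= !qdim_nsum /= !muln1 => /addIn.
  by rewrite ?addn1.
have r12 := qf_cancel_nondeg k2 ndt (qf_iso_rep iXt).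
have r21 := qf_cancel_nondeg k2 ndt (qf_iso_rep (qf_iso_sym iXt)).
have eb : b1 = b2.
  case: (ltngtP b1 b2) => // lt; case: nsa.
    exact: (sos_of_rep k2 lt (esym dimE) r12).
  exact: (sos_of_rep k2 lt dimE r21).
have ea : a1 = a2 by move: dimE; rewrite eb => /addIn.
have int_eq (p q : int) : (ipos p + ineg q = ipos q + ineg p)%N -> p = q.
  by case: p q => [m|m] [n|n] /=; rewrite ?addn0 ?add0n => e; try lia; rewrite ?e.
move=> C /imsetP[H _ ->]; have [->|->] := subgroup_order2 H z2; exact: int_eq.
Qed.

End OrderTwo.
End QuadraticDress.

(** * Quadratic extensions and Galois groups of order 2 *)

Section QuadraticGaloisGroup.
Variables (k : fieldType) (L : splittingFieldType k).
Hypothesis k2 : (2%:R : k) != 0.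
Hypothesis galL : galois 1%AS {:L}%AS.
Hypothesis L1 : (1%VS : {vspace L}) != fullv.

(** An automorphism is determined by the image of s, which is s or -s; some automorphism moves s
    because L differs from k. *)
Lemma GalG_quadratic (alpha : k) (s : L) :
  s ^+ 2 = alpha%:A -> <<1%VS; s>>%VS = fullv ->
  exists2 z : gal_of {:L}, GalG L = <[z]>%g & [/\ z s = - s, s != 0 & #[z]%g = 2%N].
Proof.
move=> s2 ks; have L2 := char_ext k2 L.
have fix_s (x : gal_of {:L}) : x s = s -> x = 1%g.
  move=> xs; apply/eqP/gal_eqP => a _; rewrite gal_id; apply/eqP.
  rewrite -mem_fixedField_cycle.
  have : (<<1%AS; s>> <= fixedField_aspace <[x]>%G)%VS.
    by apply/FadjoinP; rewrite sub1v mem_fixedField_cycle xs.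
  by rewrite ks => /subvP; apply; rewrite memvf.
have xs (x : gal_of {:L}) : x s = s \/ x s = - s.
  have : x s ^+ 2 == s ^+ 2 by rewrite -rmorphXn /= s2 linearZ /= rmorph1.
  by rewrite eqf_sqr => /orP[]/eqP; [left | right].
have [z zs] : exists z : gal_of {:L}, z s <> s.
  apply: NNPP => nz; case/negP: L1; rewrite -ks eqEsubv sub1v /=.
  have s1 : s \in 1%VS.
    rewrite -(fixedField_GalG galL); apply/fixedFieldP; rewrite ?memvf // => x _.
    by apply: NNPP => xs'; apply: nz; exists x.
  by apply/(FadjoinP (K := 1%AS) (E := 1%AS)); rewrite subvv.
have zN : z s = - s by case: (xs z).
have s0 : s != 0 by apply/eqP => s0; apply: zs; rewrite s0 rmorph0.
have zz : (z * z = 1)%g.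
  by apply: fix_s; rewrite galM ?memvf // zN rmorphN /= zN opprK.
have z1 : z != 1%g by apply/eqP => z1; apply: zs; rewrite z1 gal_id.
exists z; last first.
  by split=> //; apply: nt_prime_order => //; rewrite expgS expg1.
apply/setP=> x; rewrite mem_GalG; apply/esym; have [/fix_s->|xN] := xs x; first exact: group1.
have /fix_s e : (x * z)%g s = s by rewrite galM ?memvf // xN rmorphN /= zN opprK.
have -> : x = z by apply: (mulIg z); rewrite e zz.
exact: cycle_id.
Qed.

Lemma quadratic_of_GalG : (#|GalG L| <= 2)%N ->
  exists z (alpha : k) (s : L), [/\ GalG L = <[z]>%g, z s = - s, s != 0,
    forall a, z (z a) = a & s ^+ 2 = alpha%:A /\ <<1%VS; s>>%VS = fullv].
Proof.
move=> G2; have L2 := char_ext k2 L.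
have [z zG z1] : exists2 z, z \in GalG L & z != 1%g.
  apply/trivgPn; apply: contra L1 => /eqP G1.
  have e : GalG L = (1%G : {group gal_of {:L}}) by exact: G1.
  by rewrite -(fixedField_GalG galL) e fixedField1.
have zz : (z * z = 1)%g.
  have z2 : (#[z]%g <= 2)%N by apply: leq_trans (subset_leq_card _) G2; rewrite cycle_subG.
  apply/eqP; rewrite -[(z * z)%g]/(z ^+ 2)%g -order_dvdn.
  by move: (order_gt0 z) z2; case: #[z]%g => [|[|[]]].
have zzE a : z (z a) = a by rewrite -galM ?memvf // zz gal_id.
have oz : #[z]%g = 2%N by apply: nt_prime_order => //; rewrite expgS expg1.
have Gz : GalG L = <[z]>%g.
  apply/eqP; rewrite eq_sym eqEcard cycle_subG zG /= -orderE.
  by rewrite oz.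
have fixE a : z a = a -> a \in 1%VS.
  by move=> za; rewrite -(fixedField_GalG galL) Gz mem_fixedField_cycle za.
have [u _ zu] : exists2 u, u \in fixedField (1%G : {group gal_of {:L}}) & z u != u.
  by apply: fixedField_moved; rewrite inE.
pose s := u - z u.
have zs : z s = - s by rewrite /s rmorphB /= zzE opprB.
have s0 : s != 0 by rewrite subr_eq0 eq_sym.
have /vlineP[alpha s2] : s ^+ 2 \in 1%VS by apply: fixE; rewrite rmorphXn /= zs sqrrN.
exists z, alpha, s; split=> //; split=> //.
apply/eqP; rewrite eqEsubv subvf /=; apply/subvP => a _.
(* Even and odd parts of a under z; both coefficients are fixed by z, hence lie in k. *)
have -> : a = (a + z a) / 2%:R + (a - z a) / (2%:R * s) * s.
  by field; rewrite s0 L2.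
have sub1 : {subset (1%VS : {vspace L}) <= <<1; s>>%VS}.
  exact/subvP/subv_adjoin.
apply: rpredD; last (apply: rpredM; last exact: memv_adjoin).
  by apply/sub1/fixE; rewrite fmorph_div rmorphD rmorph_nat /= zzE addrC.
apply/sub1/fixE; rewrite fmorph_div rmorphB rmorphM rmorph_nat /= zzE zs.
by field; rewrite oppr_eq0 s0 L2.
Qed.

Lemma sos_in_alg (alpha : k) (F : fieldExtType k) : sos alpha -> sos (alpha%:A : F).
Proof.
case=> r ->; exists [seq x%:A | x <- r]; rewrite big_map scaler_suml.
by apply: eq_bigr => x _; rewrite -[RHS](rmorphXn (in_alg F)).
Qed.

Lemma dress_injective_not_sos z (alpha : k) (s : L) : GalG L = <[z]>%g -> z s = - s ->
  s != 0 -> (forall a, z (z a) = a) -> s ^+ 2 = alpha%:A -> dress_injective L -> ~ sos alpha.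
Proof.
move=> Gz zs s0 zz s2 inj sa; apply: (_ : ~ dress_injective L) inj.
pose d : subvs_of (fixedField_aspace <[z]>%G) := alpha%:A.
have dt : vsval d = s ^+ 2 by rewrite s2 linearZ rmorph1.
apply: (dress_not_injective_quadratic k2 (H1 := 1%G) (H2 := <[z]>%G) (z := z) _ _ _ _ _ s0 zs dt).
- exact: sub1G.
- rewrite cards1 eq_sym -orderE order_eq1; apply: contra s0 => /eqP z1.
  move: zs; rewrite z1 gal_id => /eqP; rewrite -addr_eq0 -mulr2n -mulr_natl mulf_eq0.
  by rewrite (negPf (char_ext k2 L)).
- exact: cycle_id.
- by move=> a _; rewrite mem_fixedField_cycle rmorphD /= zz addrC.
- exact: (eq_ind_r (fun U : {vspace L} => s \in U) (memvf s) (fixedField1 L)).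
exact: sos_in_alg.
Qed.

End QuadraticGaloisGroup.

Theorem theorem1p1 (k : fieldType) (L : splittingFieldType k) :
  (2%:R : k) != 0 ->
  galois 1%AS {:L}%AS ->
  (1%VS : {vspace L}) != fullv ->
  dress_injective L <->
  exists alpha : k, [/\ alpha != 0, ~ sum_of_squares alpha &
    exists s : L, s ^+ 2 = alpha%:A /\ <<1%VS; s>>%VS = fullv].
Proof.
move=> k2 galL L1; split=> [inj|[alpha [a0 nsa [s [s2 ks]]]]].
  have [|G2] := leqP #|GalG L| 2; last by case: (dress_not_injective_big k2 G2 inj).
  case/(quadratic_of_GalG k2 galL L1) => z [alpha [s [Gz zs s0 zz [s2 ks]]]].
  have a0 : alpha != 0.
    by apply: contra_neq s0 => a0; apply/eqP; rewrite -sqrf_eq0 s2 a0 scale0r.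
  exists alpha; split=> //; last by exists s.
  by move/(sum_of_squaresP a0); apply: dress_injective_not_sos Gz zs s0 zz s2 inj.
have [z Gz [zs s0 z2]] := GalG_quadratic k2 galL L1 s2 ks.
have zz a : z (z a) = a.
  by rewrite -galM ?memvf // -[(z * z)%g]/(z ^+ 2)%g -z2 expg_order gal_id.
apply: (dress_injective_quadratic k2 galL Gz zs s0 s2 zz z2).
by move/(sum_of_squaresP a0).
Qed.
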